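(* Let $X$ be a scheme over a field $K$ with $\mathrm{char}(K)\neq 2,3$. Let $E$ be a locally free sheaf over $X$ with a full flag structure $\mathcal F$. Let $\mathcal U=\{U_i\}_{i\in I}$ be an open cover of $X$ and $g=\{g_{ij}\}$ a system of transition functions of $E$ with respect to $\mathcal F$ and $\mathcal U$. Then, for $k\geq 1$, there is a well-defined Čech $k$-cocycle $$\widehat f^r_{k,\mathcal U}(E,\mathcal F):=\bigoplus_{i_1<\cdots<i_{k+1}}t_{i_1\cdots i_{k+1}}\in\bigoplus_{i_1<\cdots<i_{k+1}}\Gamma(U_{i_1\cdots i_{k+1}},d\Omega^{k-1}),$$ where $$t_{i_1\cdots i_{k+1}}:=\sum_{\sigma\in S_{k+1}}\frac{\mathrm{sgn}(\sigma)}{(k+1)!}\,\mathrm{tr}\Big(\prod_{l=1}^{k} g^{-1}_{i_{\sigma(l)}i_{\sigma(k+1)}}dg_{i_{\sigma(l)}i_{\sigma(k+1)}}\Big)$$ (factors ordered $l=1,\dots,k$ from left to right). Denote by $f_k^r(E,\mathcal F)$ the image of $\widehat f^r_{k,\mathcal U}(E,\mathcal F)$ in $\check H^k(X,d\Omega^{k-1})$ under the canonical homomorphism. Then $f_k^r(E,\mathcal F)$ is independent of the choice of $\mathcal U$. It is called the refined $k$-th $T$ invariant of $E$ with respect to $\mathcal F$.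
   Context: Open covers are in the Zariski topology and $I$ is an ordered set. $\Omega^1=\Omega_{X/\mathrm{Spec}\,K}$ is the sheaf of Kähler differentials, $\Omega^k$ its $k$-th exterior power, $d$ the exterior derivative, and $d\Omega^{k-1}$ is the sheaf of $d$-closed sections of $\Omega^k$ (as in the complex case, where $d\Omega^q$ denotes the sheaf of closed $(q+1)$-forms). The rank of $E$ is denoted $M$. A full flag structure $\mathcal F$ on $E$ is a filtration $E=E_M\supset E_{M-1}\supset\cdots\supset E_1\supset E_0=0$ by locally free subsheaves with invertible quotients $E_i/E_{i-1}$. A system of transition functions with respect to $\mathcal F$ and $\mathcal U$ consists of the upper triangular matrices $g_{ij}=\phi_i\circ\phi_j^{-1}\in GL_M(\mathcal O_X(U_i\cap U_j))$ arising from trivializations $\phi_i:E|_{U_i}\to\mathcal O_{U_i}^M$ mapping each $E_p|_{U_i}$ onto $\mathcal O_{U_i}^p\oplus0$. $U_{i_1\cdots i_p}=U_{i_1}\cap\cdots\cap U_{i_p}$; $dg_{ij}$ is the entrywise differential; products are matrix products with entries multiplied in the exterior algebra; $S_{k+1}$ is the permutation group of $\{1,\dots,k+1\}$. The Čech differential is $(\partial s)_{i_1\cdots i_{k+2}}=\sum_j(-1)^{j+1}s_{i_1\cdots\widehat{i_j}\cdots i_{k+2}}$, and $\check H^k(X,\cdot)=\varinjlim_{\mathcal U}\check H^k(\mathcal U,\cdot)$ over open covers under refinement. *)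

(* Defs.v *)
From HB Require Import structures.
From Stdlib Require Import Relation_Operators.
From mathcomp Require Import all_boot all_order all_algebra perm.
From mathcomp Require Import all_classical topology_structure.

Set Implicit Arguments.
Unset Strict Implicit.
Unset Printing Implicit Defensive.

Import GRing.Theory.
Local Open Scope classical_set_scope.
Local Open Scope quotient_scope.
Local Open Scope ring_scope.

(* Omega_{A/k}: the A-module presented by generators da (a in A) and the
   relations of a k-derivation. *)
Section Kaehler.
Variables (k A : comPzRingType) (f : {rmorphism k -> A}).

Inductive kterm : Type :=
  | KZero
  | KAdd of kterm & kterm
  | KScale of A & kterm
  | KD of A.

Inductive krel : kterm -> kterm -> Prop :=
  | krel_refl t : krel t t
  | krel_sym t u : krel t u -> krel u t
  | krel_trans u t v : krel t u -> krel u v -> krel t v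
  | krel_cadd t t' u u' : krel t t' -> krel u u' -> krel (KAdd t u) (KAdd t' u')
  | krel_cscale a t t' : krel t t' -> krel (KScale a t) (KScale a t')
  | krel_addA t u v : krel (KAdd t (KAdd u v)) (KAdd (KAdd t u) v)
  | krel_addC t u : krel (KAdd t u) (KAdd u t)
  | krel_add0 t : krel (KAdd KZero t) t
  | krel_addN t : krel (KAdd (KScale (-1) t) t) KZero
  | krel_scaleA a b t : krel (KScale a (KScale b t)) (KScale (a * b) t)
  | krel_scale1 t : krel (KScale 1 t) t
  | krel_scaleDr a t u :
      krel (KScale a (KAdd t u)) (KAdd (KScale a t) (KScale a u))
  | krel_scaleDl a b t :
      krel (KScale (a + b) t) (KAdd (KScale a t) (KScale b t))
  | krel_DD a b : krel (KD (a + b)) (KAdd (KD a) (KD b))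
  | krel_DM a b : krel (KD (a * b)) (KAdd (KScale a (KD b)) (KScale b (KD a)))
  | krel_Dcst c : krel (KD (f c)) KZero.

Definition krelb (t u : {classic kterm}) : bool := `[< krel t u >].

Lemma krelb_refl : reflexive krelb.
Proof. by move=> t; apply/asboolP; exact: krel_refl. Qed.

Lemma krelb_sym : symmetric krelb.
Proof. by move=> t u; apply/asboolP/asboolP; exact: krel_sym. Qed.

Lemma krelb_trans : transitive krelb.
Proof.
by move=> u t v /asboolP tu /asboolP uv; apply/asboolP; exact: krel_trans uv.
Qed.

Canonical krel_equiv := EquivRel krelb krelb_refl krelb_sym krelb_trans.

Definition kaehler : Type := {eq_quot krel_equiv}.

HB.instance Definition _ := Choice.on kaehler.

Definition kpi (t : kterm) : kaehler := \pi_({eq_quot krel_equiv}) t.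
Definition krepr (w : kaehler) : kterm := repr (w : {eq_quot krel_equiv}).

Lemma kreprK w : kpi (krepr w) = w.
Proof. exact: reprK. Qed.

Lemma kpiP t u : kpi t = kpi u <-> krel t u.
Proof.
by split=> [/eqmodP/asboolP//|tu]; apply/eqmodP/asboolP.
Qed.

Lemma krepr_pi t : krel (krepr (kpi t)) t.
Proof. by apply/kpiP; rewrite kreprK. Qed.

Definition kzero := kpi KZero.
Definition kadd v w := kpi (KAdd (krepr v) (krepr w)).
Definition kscale a w := kpi (KScale a (krepr w)).
Definition kopp w := kscale (-1) w.

Lemma kpiD t u : kpi (KAdd t u) = kadd (kpi t) (kpi u).
Proof. by apply/kpiP/krel_sym/krel_cadd; exact: krepr_pi. Qed.

Lemma kpiZ a t : kpi (KScale a t) = kscale a (kpi t).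
Proof. by apply/kpiP/krel_sym/krel_cscale; exact: krepr_pi. Qed.

Lemma kaddA : associative kadd.
Proof.
move=> u v w; rewrite -(kreprK u) -(kreprK v) -(kreprK w) -!kpiD.
exact/kpiP/krel_addA.
Qed.

Lemma kaddC : commutative kadd.
Proof.
by move=> u v; rewrite -(kreprK u) -(kreprK v) -!kpiD; exact/kpiP/krel_addC.
Qed.

Lemma kadd0 : left_id kzero kadd.
Proof. by move=> u; rewrite -(kreprK u) -!kpiD; exact/kpiP/krel_add0. Qed.

Lemma kaddN : left_inverse kzero kopp kadd.
Proof.
by move=> u; rewrite /kopp -(kreprK u) -kpiZ -!kpiD; exact/kpiP/krel_addN.
Qed.

HB.instance Definition _ :=
  GRing.isZmodule.Build kaehler kaddA kaddC kadd0 kaddN.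

Lemma kpi_add t u : kpi (KAdd t u) = kpi t + kpi u. Proof. exact: kpiD. Qed.

Lemma kscaleA a b v : kscale a (kscale b v) = kscale (a * b) v.
Proof. by rewrite -(kreprK v) -!kpiZ; exact/kpiP/krel_scaleA. Qed.

Lemma kscale1 : left_id 1 kscale.
Proof. by move=> v; rewrite -(kreprK v) -!kpiZ; exact/kpiP/krel_scale1. Qed.

Lemma kscaleDr : right_distributive kscale +%R.
Proof.
move=> a u v; rewrite -(kreprK u) -(kreprK v) -kpi_add -!kpiZ -kpi_add.
exact/kpiP/krel_scaleDr.
Qed.

Lemma kscaleDl v : {morph kscale^~ v : a b / a + b}.
Proof.
move=> a b; rewrite -(kreprK v) -!kpiZ -kpi_add; exact/kpiP/krel_scaleDl.
Qed.

HB.instance Definition _ :=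
  GRing.Zmodule_isLmodule.Build A kaehler kscaleA kscale1 kscaleDr kscaleDl.

Definition kD (a : A) : kaehler := kpi (KD a).

Lemma kpi_scale a t : kpi (KScale a t) = a *: kpi t. Proof. exact: kpiZ. Qed.

Lemma kDD a b : kD (a + b) = kD a + kD b.
Proof. by rewrite -kpi_add; exact/kpiP/krel_DD. Qed.

Lemma kDM a b : kD (a * b) = a *: kD b + b *: kD a.
Proof. by rewrite -!kpi_scale -kpi_add; exact/kpiP/krel_DM. Qed.

Lemma kD_cst c : kD (f c) = 0.
Proof. exact/kpiP/krel_Dcst. Qed.

Lemma kaehler_ind (P : kaehler -> Prop) :
  P 0 -> (forall v w, P v -> P w -> P (v + w)) ->
  (forall a v, P v -> P (a *: v)) -> (forall a, P (kD a)) -> forall w, P w.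
Proof.
move=> P0 PD PZ Pd w; rewrite -(kreprK w); elim: (krepr w) => //.
- by move=> t Pt u Pu; rewrite kpi_add; exact: PD.
- by move=> a t Pt; rewrite kpi_scale; exact: PZ.
Qed.

End Kaehler.

(* Lambda_A(M): the A-algebra presented by generators m in M, linear in m,
   and the relations m * m = 0, i.e. the tensor algebra of M modulo the
   two-sided ideal generated by the squares of the elements of M. *)
Section Exterior.
Variables (A : comPzRingType) (M : lmodType A).

Inductive eterm : Type :=
  | ECst of A
  | EGen of M
  | EAdd of eterm & eterm
  | EMul of eterm & eterm.

Inductive erel : eterm -> eterm -> Prop :=
  | erel_refl t : erel t t
  | erel_sym t u : erel t u -> erel u t
  | erel_trans u t v : erel t u -> erel u v -> erel t v
  | erel_cadd t t' u u' : erel t t' -> erel u u' -> erel (EAdd t u) (EAdd t' u')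
  | erel_cmul t t' u u' : erel t t' -> erel u u' -> erel (EMul t u) (EMul t' u')
  | erel_addA t u v : erel (EAdd t (EAdd u v)) (EAdd (EAdd t u) v)
  | erel_addC t u : erel (EAdd t u) (EAdd u t)
  | erel_add0 t : erel (EAdd (ECst 0) t) t
  | erel_addN t : erel (EAdd (EMul (ECst (-1)) t) t) (ECst 0)
  | erel_mulA t u v : erel (EMul t (EMul u v)) (EMul (EMul t u) v)
  | erel_mul1l t : erel (EMul (ECst 1) t) t
  | erel_mul1r t : erel (EMul t (ECst 1)) t
  | erel_mulDl t u v : erel (EMul (EAdd t u) v) (EAdd (EMul t v) (EMul u v))
  | erel_mulDr t u v : erel (EMul t (EAdd u v)) (EAdd (EMul t u) (EMul t v))
  | erel_cstD a b : erel (ECst (a + b)) (EAdd (ECst a) (ECst b))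
  | erel_cstM a b : erel (ECst (a * b)) (EMul (ECst a) (ECst b))
  | erel_cstC a t : erel (EMul (ECst a) t) (EMul t (ECst a))
  | erel_genD m n : erel (EGen (m + n)) (EAdd (EGen m) (EGen n))
  | erel_genZ a m : erel (EGen (a *: m)) (EMul (ECst a) (EGen m))
  | erel_alt m : erel (EMul (EGen m) (EGen m)) (ECst 0).

Definition erelb (t u : {classic eterm}) : bool := `[< erel t u >].

Lemma erelb_refl : reflexive erelb.
Proof. by move=> t; apply/asboolP; exact: erel_refl. Qed.

Lemma erelb_sym : symmetric erelb.
Proof. by move=> t u; apply/asboolP/asboolP; exact: erel_sym. Qed.

Lemma erelb_trans : transitive erelb.
Proof.
by move=> u t v /asboolP tu /asboolP uv; apply/asboolP; exact: erel_trans uv.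
Qed.

Canonical erel_equiv := EquivRel erelb erelb_refl erelb_sym erelb_trans.

Definition exterior : Type := {eq_quot erel_equiv}.

HB.instance Definition _ := Choice.on exterior.

Definition epi (t : eterm) : exterior := \pi_({eq_quot erel_equiv}) t.
Definition erepr (w : exterior) : eterm := repr (w : {eq_quot erel_equiv}).

Lemma ereprK w : epi (erepr w) = w.
Proof. exact: reprK. Qed.

Lemma epiP t u : epi t = epi u <-> erel t u.
Proof. by split=> [/eqmodP/asboolP//|tu]; apply/eqmodP/asboolP. Qed.

Lemma erepr_pi t : erel (erepr (epi t)) t.
Proof. by apply/epiP; rewrite ereprK. Qed.

Definition ecst (a : A) : exterior := epi (ECst a).
Definition egen (m : M) : exterior := epi (EGen m).
Definition eadd v w := epi (EAdd (erepr v) (erepr w)).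
Definition emul v w := epi (EMul (erepr v) (erepr w)).
Definition eopp w := emul (ecst (-1)) w.

Lemma epiD t u : epi (EAdd t u) = eadd (epi t) (epi u).
Proof. by apply/epiP/erel_sym/erel_cadd; exact: erepr_pi. Qed.

Lemma epiM t u : epi (EMul t u) = emul (epi t) (epi u).
Proof. by apply/epiP/erel_sym/erel_cmul; exact: erepr_pi. Qed.

Lemma eaddA : associative eadd.
Proof.
move=> u v w; rewrite -(ereprK u) -(ereprK v) -(ereprK w) -!epiD.
exact/epiP/erel_addA.
Qed.

Lemma eaddC : commutative eadd.
Proof.
by move=> u v; rewrite -(ereprK u) -(ereprK v) -!epiD; exact/epiP/erel_addC.
Qed.

Lemma eadd0 : left_id (ecst 0) eadd.
Proof. by move=> u; rewrite -(ereprK u) -!epiD; exact/epiP/erel_add0. Qed.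

Lemma eaddN : left_inverse (ecst 0) eopp eadd.
Proof.
by move=> u; rewrite /eopp -(ereprK u) -epiM -!epiD; exact/epiP/erel_addN.
Qed.

HB.instance Definition _ :=
  GRing.isZmodule.Build exterior eaddA eaddC eadd0 eaddN.

Lemma epi_add t u : epi (EAdd t u) = epi t + epi u. Proof. exact: epiD. Qed.

Lemma emulA : associative emul.
Proof.
move=> u v w; rewrite -(ereprK u) -(ereprK v) -(ereprK w) -!epiM.
exact/epiP/erel_mulA.
Qed.

Lemma emul1l : left_id (ecst 1) emul.
Proof. by move=> u; rewrite -(ereprK u) -!epiM; exact/epiP/erel_mul1l. Qed.

Lemma emul1r : right_id (ecst 1) emul.
Proof. by move=> u; rewrite -(ereprK u) -!epiM; exact/epiP/erel_mul1r. Qed.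

Lemma emulDl : left_distributive emul +%R.
Proof.
move=> u v w; rewrite -(ereprK u) -(ereprK v) -(ereprK w).
by rewrite -epi_add -!epiM -epi_add; exact/epiP/erel_mulDl.
Qed.

Lemma emulDr : right_distributive emul +%R.
Proof.
move=> u v w; rewrite -(ereprK u) -(ereprK v) -(ereprK w).
by rewrite -epi_add -!epiM -epi_add; exact/epiP/erel_mulDr.
Qed.

HB.instance Definition _ :=
  GRing.Zmodule_isPzRing.Build exterior emulA emul1l emul1r emulDl emulDr.

Lemma epi_mul t u : epi (EMul t u) = epi t * epi u. Proof. exact: epiM. Qed.

Lemma ecstD a b : ecst (a + b) = ecst a + ecst b.
Proof. by rewrite -epi_add; exact/epiP/erel_cstD. Qed.

Lemma ecst_is_zmod_morphism : zmod_morphism ecst.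
Proof.
by move=> a b; apply: (addIr (ecst b)); rewrite -ecstD !subrK.
Qed.

Lemma ecst_is_monoid_morphism : monoid_morphism ecst.
Proof.
by split=> // a b; rewrite -epi_mul; exact/epiP/erel_cstM.
Qed.

HB.instance Definition _ :=
  GRing.isZmodMorphism.Build A exterior ecst ecst_is_zmod_morphism.
HB.instance Definition _ :=
  GRing.isMonoidMorphism.Build A exterior ecst ecst_is_monoid_morphism.

Lemma ecstC a w : ecst a * w = w * ecst a.
Proof. by rewrite -(ereprK w) -!epi_mul; exact/epiP/erel_cstC. Qed.

Lemma egenD m n : egen (m + n) = egen m + egen n.
Proof. by rewrite -epi_add; exact/epiP/erel_genD. Qed.

Lemma egen_is_zmod_morphism : zmod_morphism egen.
Proof.
by move=> a b; apply: (addIr (egen b)); rewrite -egenD !subrK.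
Qed.

HB.instance Definition _ :=
  GRing.isZmodMorphism.Build M exterior egen egen_is_zmod_morphism.

Lemma egenZ a m : egen (a *: m) = ecst a * egen m.
Proof. by rewrite -epi_mul; exact/epiP/erel_genZ. Qed.

Lemma egen_sqr m : egen m * egen m = 0.
Proof. by rewrite -epi_mul; exact/epiP/erel_alt. Qed.

Lemma egen_anti m n : egen m * egen n = - (egen n * egen m).
Proof.
apply/eqP; rewrite -addr_eq0; apply/eqP.
have := egen_sqr (m + n).
by rewrite egenD mulrDl !mulrDr !egen_sqr add0r addr0.
Qed.

Lemma exterior_ind (P : exterior -> Prop) :
  (forall a, P (ecst a)) -> (forall m, P (egen m)) ->
  (forall v w, P v -> P w -> P (v + w)) ->
  (forall v w, P v -> P w -> P (v * w)) -> forall w, P w.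
Proof.
move=> Pc Pg PD PM w; rewrite -(ereprK w); elim: (erepr w) => //.
- by move=> t Pt u Pu; rewrite epi_add; exact: PD.
- by move=> t Pt u Pu; rewrite epi_mul; exact: PM.
Qed.

(* The k-th exterior power, inside the exterior algebra. *)
Definition ext_pow (k : nat) (w : exterior) : Prop :=
  exists (n : nat) (a : 'I_n -> A) (m : 'I_n -> 'I_k -> M),
    w = \sum_(j < n) ecst (a j) * \prod_(l < k) egen (m j l).

End Exterior.

(* The grading involution of Lambda(M): (-1)^k in degree k. *)
Section Involution.
Variables (A : comPzRingType) (M : lmodType A).

Fixpoint einvt (t : eterm M) : exterior M :=
  match t with
  | ECst a => ecst M a
  | EGen m => - egen m
  | EAdd t u => einvt t + einvt u
  | EMul t u => einvt t * einvt u
  end.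

Lemma einvt_rel t u : erel t u -> einvt t = einvt u.
Proof.
elim=> //=; clear.
- by move=> t u v _ -> _ ->.
- by move=> t t' u u' _ -> _ ->.
- by move=> t t' u u' _ -> _ ->.
- by move=> t u v; rewrite addrA.
- by move=> t u; rewrite addrC.
- by move=> t; rewrite rmorph0 add0r.
- by move=> t; rewrite rmorphN1 rmorph0 mulN1r addNr.
- by move=> t u v; rewrite mulrA.
- by move=> t; rewrite rmorph1 mul1r.
- by move=> t; rewrite rmorph1 mulr1.
- by move=> t u v; rewrite mulrDl.
- by move=> t u v; rewrite mulrDr.
- by move=> a b; rewrite rmorphD.
- by move=> a b; rewrite rmorphM.
- by move=> a t; rewrite ecstC.
- by move=> m n; rewrite raddfD opprD.
- by move=> a m; rewrite egenZ mulrN.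
- by move=> m; rewrite mulrNN egen_sqr rmorph0.
Qed.

Definition einv (w : exterior M) : exterior M := einvt (erepr w).

Lemma einv_pi t : einv (epi t) = einvt t.
Proof. exact/einvt_rel/erepr_pi. Qed.

Lemma einv_cst a : einv (ecst M a) = ecst M a. Proof. exact: einv_pi. Qed.
Lemma einv_gen m : einv (egen m) = - egen m. Proof. exact: einv_pi. Qed.

Lemma einvD v w : einv (v + w) = einv v + einv w.
Proof. by rewrite -(ereprK v) -(ereprK w) -epi_add !einv_pi. Qed.

Lemma einvM v w : einv (v * w) = einv v * einv w.
Proof. by rewrite -(ereprK v) -(ereprK w) -epi_mul !einv_pi. Qed.

Lemma egen_einv m w : egen m * w = einv w * egen m.
Proof.
elim/exterior_ind: w => [a|n|v w Hv Hw|v w Hv Hw].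
- by rewrite einv_cst ecstC.
- by rewrite einv_gen mulNr -egen_anti.
- by rewrite einvD mulrDr mulrDl Hv Hw.
- by rewrite einvM mulrA Hv -mulrA Hw mulrA.
Qed.

End Involution.

Section ExteriorDerivative.
Variables (k A : comPzRingType) (f : {rmorphism k -> A}).

Local Notation Om := (kaehler f).
Local Notation DR := (exterior Om).

(* On 1-forms: d (a db) = da db. *)
Fixpoint kdt (t : kterm A) : DR :=
  match t with
  | KZero => 0
  | KAdd t u => kdt t + kdt u
  | KScale a t => egen (kD f a) * egen (kpi f t) + ecst Om a * kdt t
  | KD _ => 0
  end.

Lemma kD1 : kD f 1 = 0.
Proof. by rewrite -(rmorph1 f) kD_cst. Qed.

Lemma kDN1 : kD f (-1) = 0.
Proof. by rewrite -(rmorph1 f) -rmorphN kD_cst. Qed.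

Lemma kdt_rel t u : krel f t u -> kdt t = kdt u.
Proof.
elim=> //=; clear.
- by move=> t u v _ -> _ ->.
- by move=> t t' u u' _ -> _ ->.
- by move=> a t t' /kpiP -> ->.
- by move=> t u v; rewrite addrA.
- by move=> t u; rewrite addrC.
- by move=> t; rewrite add0r.
- by move=> t; rewrite kDN1 raddf0 mul0r add0r rmorphN1 mulN1r addNr.
- move=> a b t; rewrite kpi_scale egenZ kDM raddfD /= !egenZ rmorphM /=.
  rewrite mulrDr mulrDl !addrA; congr (_ + _); last by rewrite mulrA.
  by rewrite addrC mulrA -ecstC !mulrA.
- by move=> t; rewrite kD1 raddf0 mul0r add0r rmorph1 mul1r.
- by move=> a t u; rewrite kpi_add raddfD /= !mulrDr addrACA.
- by move=> a b t; rewrite kDD raddfD rmorphD /= !mulrDl addrACA.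
- by rewrite addr0.
- by move=> a b; rewrite !mulr0 !addr0 egen_anti addNr.
Qed.

Definition kd (w : Om) : DR := kdt (krepr w).

Lemma kd_pi t : kd (kpi f t) = kdt t.
Proof. exact/kdt_rel/krepr_pi. Qed.

Lemma kdD v w : kd (v + w) = kd v + kd w.
Proof. by rewrite -(kreprK v) -(kreprK w) -kpi_add !kd_pi. Qed.

Lemma kdZ a w : kd (a *: w) = egen (kD f a) * egen w + ecst Om a * kd w.
Proof. by rewrite -(kreprK w) -kpi_scale !kd_pi. Qed.

Lemma kd_D a : kd (kD f a) = 0.
Proof. exact: kd_pi. Qed.

Lemma kd_0 : kd 0 = 0.
Proof. exact: (kd_pi (KZero A)). Qed.

Lemma kd_gen w m : kd w * egen m = egen m * kd w.
Proof.
elim/kaehler_ind: w.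
- by rewrite kd_0 mul0r mulr0.
- by move=> v w Hv Hw; rewrite kdD mulrDl mulrDr Hv Hw.
- move=> a v Hv; rewrite kdZ mulrDl mulrDr; congr (_ + _).
    rewrite -mulrA (egen_anti v) mulrN mulrA (egen_anti _ m).
    by rewrite mulNr opprK mulrA.
  by rewrite -mulrA Hv !mulrA -ecstC.
- by move=> a; rewrite kd_D mul0r mulr0.
Qed.

(* d is the antiderivation of Lambda(Omega) extending a |-> da. *)
Fixpoint edt (t : eterm Om) : DR :=
  match t with
  | ECst a => egen (kD f a)
  | EGen m => kd m
  | EAdd t u => edt t + edt u
  | EMul t u => edt t * epi u + einvt t * edt u
  end.

Lemma edt_rel t u : erel t u -> edt t = edt u.
Proof.
elim=> //=; clear.
- by move=> t u v _ -> _ ->.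
- by move=> t t' u u' _ -> _ ->.
- by move=> t t' u u' /[dup] /epiP _ /einvt_rel -> -> /epiP -> ->.
- by move=> t u v; rewrite addrA.
- by move=> t u; rewrite addrC.
- by move=> t; rewrite -(rmorph0 f) kD_cst raddf0 add0r.
- move=> t; rewrite kDN1 raddf0 mul0r add0r rmorphN1 mulN1r addNr.
  by rewrite -(rmorph0 f) kD_cst raddf0.
- move=> t u v; rewrite !epi_mul mulrDr mulrDl !mulrA !addrA.
  by [].
- by move=> t; rewrite kD1 raddf0 mul0r add0r rmorph1 mul1r.
- by move=> t; rewrite kD1 raddf0 mulr0 addr0 -[epi _]/(ecst Om 1) rmorph1 mulr1.
- by move=> t u v; rewrite !mulrDl addrACA.
- by move=> t u v; rewrite epi_add !mulrDr addrACA.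
- by move=> a b; rewrite kDD raddfD.
- by move=> a b; rewrite kDM raddfD /= !egenZ addrC [X in X + _]ecstC.
- move=> a t; rewrite -[epi (ECst _ _)]/(ecst Om a) egen_einv einv_pi.
  by rewrite addrC ecstC.
- by move=> m n; rewrite kdD.
- by move=> a m; rewrite kdZ.
- by move=> m; rewrite mulNr kd_gen subrr -(rmorph0 f) kD_cst raddf0.
Qed.

Definition ed (w : DR) : DR := edt (erepr w).

Lemma ed_pi t : ed (epi t) = edt t.
Proof. exact/edt_rel/erepr_pi. Qed.

Lemma ed_cst a : ed (ecst Om a) = egen (kD f a). Proof. exact: ed_pi. Qed.
Lemma ed_gen m : ed (egen m) = kd m. Proof. exact: ed_pi. Qed.

Lemma edD v w : ed (v + w) = ed v + ed w.
Proof. by rewrite -(ereprK v) -(ereprK w) -epi_add !ed_pi. Qed.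

Lemma edM v w : ed (v * w) = ed v * w + einv v * ed w.
Proof.
by rewrite -(ereprK v) -(ereprK w) -epi_mul !ed_pi einv_pi.
Qed.

Lemma ed_is_zmod_morphism : zmod_morphism ed.
Proof. by move=> a b; apply: (addIr (ed b)); rewrite -edD !subrK. Qed.

HB.instance Definition _ :=
  GRing.isZmodMorphism.Build DR DR ed ed_is_zmod_morphism.

End ExteriorDerivative.

Record kalg_mor (k A B : comPzRingType) (f : {rmorphism k -> A})
    (g : {rmorphism k -> B}) := KAlgMor {
  kalg_fun :> {rmorphism A -> B};
  kalg_funE : forall c, kalg_fun (f c) = g c }.

(* Functoriality of Lambda(Omega_{A/k}) in the k-algebra A. *)
Section Functoriality.
Variables (k A B : comPzRingType).
Variables (f : {rmorphism k -> A}) (g : {rmorphism k -> B}).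
Variable phi : kalg_mor f g.

Fixpoint kmapt (t : kterm A) : kaehler g :=
  match t with
  | KZero => 0
  | KAdd t u => kmapt t + kmapt u
  | KScale a t => phi a *: kmapt t
  | KD a => kD g (phi a)
  end.

Lemma kmapt_rel t u : krel f t u -> kmapt t = kmapt u.
Proof.
elim=> //=; clear.
- by move=> t u v _ -> _ ->.
- by move=> t t' u u' _ -> _ ->.
- by move=> a t t' _ ->.
- by move=> t u v; rewrite addrA.
- by move=> t u; rewrite addrC.
- by move=> t; rewrite add0r.
- by move=> t; rewrite rmorphN1 scaleN1r addNr.
- by move=> a b t; rewrite scalerA rmorphM.
- by move=> t; rewrite rmorph1 scale1r.
- by move=> a t u; rewrite scalerDr.
- by move=> a b t; rewrite rmorphD scalerDl.
- by move=> a b; rewrite rmorphD kDD.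
- by move=> a b; rewrite rmorphM kDM.
- by move=> c; rewrite kalg_funE kD_cst.
Qed.

Definition kmap (w : kaehler f) : kaehler g := kmapt (krepr w).

Lemma kmap_pi t : kmap (kpi f t) = kmapt t.
Proof. exact/kmapt_rel/krepr_pi. Qed.

Lemma kmapD v w : kmap (v + w) = kmap v + kmap w.
Proof. by rewrite -(kreprK v) -(kreprK w) -kpi_add !kmap_pi. Qed.

Lemma kmapZ a w : kmap (a *: w) = phi a *: kmap w.
Proof. by rewrite -(kreprK w) -kpi_scale !kmap_pi. Qed.

Lemma kmap_D a : kmap (kD f a) = kD g (phi a).
Proof. exact: kmap_pi. Qed.

Lemma kmap0 : kmap 0 = 0.
Proof. exact: (kmap_pi (KZero A)). Qed.

Local Notation DRA := (exterior (kaehler f)).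
Local Notation DRB := (exterior (kaehler g)).

Fixpoint emapt (t : eterm (kaehler f)) : DRB :=
  match t with
  | ECst a => ecst _ (phi a)
  | EGen m => egen (kmap m)
  | EAdd t u => emapt t + emapt u
  | EMul t u => emapt t * emapt u
  end.

Lemma emapt_rel t u : erel t u -> emapt t = emapt u.
Proof.
elim=> //=; clear.
- by move=> t u v _ -> _ ->.
- by move=> t t' u u' _ -> _ ->.
- by move=> t t' u u' _ -> _ ->.
- by move=> t u v; rewrite addrA.
- by move=> t u; rewrite addrC.
- by move=> t; rewrite !rmorph0 add0r.
- by move=> t; rewrite !rmorphN1 !rmorph0 mulN1r addNr.
- by move=> t u v; rewrite mulrA.
- by move=> t; rewrite !rmorph1 mul1r.
- by move=> t; rewrite !rmorph1 mulr1.
- by move=> t u v; rewrite mulrDl.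
- by move=> t u v; rewrite mulrDr.
- by move=> a b; rewrite !rmorphD.
- by move=> a b; rewrite !rmorphM.
- by move=> a t; rewrite ecstC.
- by move=> m n; rewrite kmapD raddfD.
- by move=> a m; rewrite kmapZ egenZ.
- by move=> m; rewrite egen_sqr !rmorph0.
Qed.

Definition emap (w : DRA) : DRB := emapt (erepr w).

Lemma emap_pi t : emap (epi t) = emapt t.
Proof. exact/emapt_rel/erepr_pi. Qed.

Lemma emap_cst a : emap (ecst _ a) = ecst _ (phi a). Proof. exact: emap_pi. Qed.
Lemma emap_gen m : emap (egen m) = egen (kmap m). Proof. exact: emap_pi. Qed.

Lemma emapD v w : emap (v + w) = emap v + emap w.
Proof. by rewrite -(ereprK v) -(ereprK w) -epi_add !emap_pi. Qed.

Lemma emapM v w : emap (v * w) = emap v * emap w.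
Proof. by rewrite -(ereprK v) -(ereprK w) -epi_mul !emap_pi. Qed.

Lemma emap_is_zmod_morphism : zmod_morphism emap.
Proof. by move=> a b; apply: (addIr (emap b)); rewrite -emapD !subrK. Qed.

Lemma emap_is_monoid_morphism : monoid_morphism emap.
Proof. by split; [rewrite emap_cst rmorph1 | exact: emapM]. Qed.

HB.instance Definition _ :=
  GRing.isZmodMorphism.Build DRA DRB emap emap_is_zmod_morphism.
HB.instance Definition _ :=
  GRing.isMonoidMorphism.Build DRA DRB emap emap_is_monoid_morphism.

Lemma emap_einv w : emap (einv w) = einv (emap w).
Proof.
elim/exterior_ind: w => [a|m|v w Hv Hw|v w Hv Hw].
- by rewrite !(einv_cst, emap_cst).
- by rewrite einv_gen raddfN /= !emap_gen einv_gen.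
- by rewrite einvD !emapD einvD Hv Hw.
- by rewrite einvM !emapM einvM Hv Hw.
Qed.

Lemma emap_kd w : emap (kd w) = kd (kmap w).
Proof.
elim/kaehler_ind: w => [|v w Hv Hw|a v Hv|a].
- by rewrite kd_0 kmap0 kd_0 raddf0.
- by rewrite kdD emapD kmapD kdD Hv Hw.
- by rewrite kdZ emapD !emapM emap_cst !emap_gen Hv kmap_D kmapZ kdZ.
- by rewrite kd_D kmap_D kd_D raddf0.
Qed.

Lemma emap_ed w : emap (ed w) = ed (emap w).
Proof.
elim/exterior_ind: w => [a|m|v w Hv Hw|v w Hv Hw].
- by rewrite ed_cst emap_gen kmap_D emap_cst ed_cst.
- by rewrite ed_gen emap_gen ed_gen emap_kd.
- by rewrite edD !emapD edD Hv Hw.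
- by rewrite edM emapD !emapM edM Hv Hw emap_einv.
Qed.

Lemma emap_ext_pow n w : ext_pow n w -> ext_pow n (emap w).
Proof.
move=> [p [a [m ->]]]; exists p, (phi \o a), (fun j l => kmap (m j l)).
rewrite raddf_sum; apply: eq_bigr => j _.
rewrite /= emapM emap_cst rmorph_prod.
by congr (_ * _); apply: eq_bigr => l _; exact: emap_gen.
Qed.

End Functoriality.

Lemma emap_comp (k A B C : comPzRingType) (f : {rmorphism k -> A})
    (g : {rmorphism k -> B}) (h : {rmorphism k -> C})
    (phi : kalg_mor f g) (psi : kalg_mor g h) (chi : kalg_mor f h) :
  (forall a, psi (phi a) = chi a) ->
  forall w, emap psi (emap phi w) = emap chi w.
Proof.
move=> E; elim/exterior_ind => [a|m|v w Hv Hw|v w Hv Hw].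
- by rewrite !emap_cst E.
- rewrite !emap_gen; congr egen.
  elim/kaehler_ind: m => [|v w Hv Hw|a v Hv|a].
  + by rewrite !kmap0.
  + by rewrite !kmapD Hv Hw.
  + by rewrite !kmapZ Hv E.
  + by rewrite !kmap_D E.
- by rewrite !emapD Hv Hw.
- by rewrite !emapM Hv Hw.
Qed.

Record opens (X : topologicalType) := Opens {
  oset :> set X;
  osetP : open oset }.

Section Opens.
Variable X : topologicalType.

Definition ofull : opens X := Opens openT.

Definition ocap (U V : opens X) : opens X := Opens (openI (osetP U) (osetP V)).

Lemma ocapl (U V : opens X) : ocap U V `<=` U. Proof. by move=> x []. Qed.
Lemma ocapr (U V : opens X) : ocap U V `<=` V. Proof. by move=> x []. Qed.

Lemma open_bigcap_ord n (U : 'I_n -> opens X) :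
  open [set x | forall j, oset (U j) x].
Proof.
elim: n => [|n IH] in U *.
  rewrite (_ : [set x | _] = setT); first exact: openT.
  by apply/seteqP; split=> // x _ [].
rewrite (_ : [set x | _] =
             U ord0 `&` [set x | forall j, oset (U (lift ord0 j)) x]).
  exact: openI (osetP _) (IH _).
apply/seteqP; split=> [x Ux|x [U0 Ux] j]; first by split=> // j; exact: Ux.
by case: (unliftP ord0 j) => [l ->|-> //]; exact: Ux.
Qed.

(* The intersection of the n opens U 0, ..., U (n - 1). *)
Definition obigcap n (U : 'I_n -> opens X) : opens X :=
  Opens (open_bigcap_ord U).

Lemma obigcap_reindex n p (U : 'I_n -> opens X) (s : 'I_p -> 'I_n) :
  obigcap U `<=` obigcap (U \o s).
Proof. by move=> x Ux j; exact: Ux. Qed.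

Lemma obigcap_mono n (U V : 'I_n -> opens X) :
  (forall j, V j `<=` U j) -> obigcap V `<=` obigcap U.
Proof. by move=> VU x Vx j; exact/VU/Vx. Qed.

Lemma obigcap_cap n (U : 'I_n -> opens X) (a b : 'I_n) :
  obigcap U `<=` ocap (U a) (U b).
Proof. by move=> x Ux; split; exact: Ux. Qed.

(* The sheaf condition for a presheaf of sets. *)
Definition is_sheaf (S : opens X -> Type)
    (res : forall U V : opens X, V `<=` U -> S U -> S V) : Prop :=
  forall (I : Type) (U : opens X) (W : I -> opens X)
      (WU : forall i, W i `<=` U),
    U `<=` \bigcup_i W i ->
    forall s : forall i, S (W i),
      (forall i j, res _ _ (@ocapl (W i) (W j)) (s i) =
                   res _ _ (@ocapr (W i) (W j)) (s j)) ->
      exists! t : S U, forall i, res _ _ (WU i) t = s i.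

End Opens.

Arguments obigcap {X n} U.

Record ring_sheaf (X : topologicalType) := RingSheaf {
  rsec :> opens X -> comPzRingType;
  rres : forall U V : opens X, V `<=` U -> {rmorphism rsec U -> rsec V};
  rres_id : forall (U : opens X) (UU : U `<=` U) a, rres UU a = a;
  rres_comp : forall (U V W : opens X) (VU : V `<=` U) (WV : W `<=` V)
    (WU : W `<=` U) a, rres WV (rres VU a) = rres WU a;
  rres_sheaf : is_sheaf (fun U V VU => rres VU) }.

Arguments rres {X} r {U V} VU.
Arguments rres_id {X} r {U} UU a.
Arguments rres_comp {X} r {U V W} VU WV WU a.

Section Stalk.
Variables (X : topologicalType) (O : ring_sheaf X) (x : X).

Record pregerm := PreGerm {
  pg_dom : opens X;
  pg_in : oset pg_dom x;
  pg_val : O pg_dom }.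

Definition grel (s t : pregerm) : Prop :=
  exists (W : opens X) (Ws : W `<=` pg_dom s) (Wt : W `<=` pg_dom t),
    oset W x /\ rres O Ws (pg_val s) = rres O Wt (pg_val t).

Definition grelb (s t : {classic pregerm}) : bool := `[< grel s t >].

Lemma grelb_refl : reflexive grelb.
Proof.
move=> s; apply/asboolP; exists (pg_dom s), (@subset_refl _ _), (@subset_refl _ _).
by split=> //; exact: pg_in.
Qed.

Lemma grelb_sym : symmetric grelb.
Proof.
by move=> s t; apply/asboolP/asboolP => -[W [Ws [Wt [Wx E]]]];
   exists W, Wt, Ws.
Qed.

Lemma grelb_trans : transitive grelb.
Proof.
move=> t s u /asboolP[W [Ws [Wt [Wx E]]]] /asboolP[V [Vt [Vu [Vx F]]]].
apply/asboolP; exists (ocap W V).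
have lW := @ocapl _ W V; have rV := @ocapr _ W V.
exists (subset_trans lW Ws), (subset_trans rV Vu); split=> //.
rewrite -(rres_comp O Ws lW) -(rres_comp O Vu rV) E -F.
by rewrite !(rres_comp O _ _ (subset_trans lW Wt)).
Qed.

Canonical grel_equiv := EquivRel grelb grelb_refl grelb_sym grelb_trans.

Definition stalk : Type := {eq_quot grel_equiv}.

HB.instance Definition _ := Choice.on stalk.

Definition germ (U : opens X) (Ux : oset U x) (a : O U) : stalk :=
  \pi_({eq_quot grel_equiv}) (PreGerm Ux a).

Lemma germ_res (U V : opens X) (Ux : oset U x) (Vx : oset V x)
    (VU : V `<=` U) a : germ Vx (rres O VU a) = germ Ux a.
Proof.
apply/eqmodP/asboolP; exists V, (@subset_refl _ _), VU; split=> //=.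
by rewrite rres_id.
Qed.

Lemma germ_eq (U V : opens X) (Ux : oset U x) (Vx : oset V x) a b :
  germ Ux a = germ Vx b <->
  exists (W : opens X) (WU : W `<=` U) (WV : W `<=` V),
    oset W x /\ rres O WU a = rres O WV b.
Proof.
split=> [/eqmodP/asboolP//|H].
by apply/eqmodP/asboolP; exact: H.
Qed.

Definition pg_of (s : stalk) : pregerm := repr (s : {eq_quot grel_equiv}).

Lemma pg_ofK s : germ (pg_in (pg_of s)) (pg_val (pg_of s)) = s.
Proof.
rewrite -[RHS](reprK (s : {eq_quot grel_equiv})) /germ /pg_of.
by congr (\pi); case: (repr _).
Qed.

Lemma germ_ex (s : stalk) : exists U (Ux : oset U x) a, s = germ Ux a.
Proof.
by exists (pg_dom (pg_of s)), (pg_in (pg_of s)), (pg_val (pg_of s));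
   rewrite pg_ofK.
Qed.

Definition germ_op2 (op : forall U, O U -> O U -> O U) (s t : stalk) : stalk :=
  let s' := pg_of s in let t' := pg_of t in
  germ (U := ocap (pg_dom s') (pg_dom t')) (conj (pg_in s') (pg_in t'))
    (op _ (rres O (@ocapl _ _ _) (pg_val s')) (rres O (@ocapr _ _ _) (pg_val t'))).

Lemma germ_op2E (op : forall U, O U -> O U -> O U) :
  (forall (U V : opens X) (VU : V `<=` U) a b,
    rres O VU (op U a b) = op V (rres O VU a) (rres O VU b)) ->
  forall U (Ux : oset U x) a b,
    germ_op2 op (germ Ux a) (germ Ux b) = germ Ux (op U a b).
Proof.
move=> opE U Ux a b; rewrite /germ_op2.
case/germ_eq: (pg_ofK (germ Ux a)) => V [V1 [V2 [Vx E]]].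
case/germ_eq: (pg_ofK (germ Ux b)) => W [W1 [W2 [Wx F]]].
apply/germ_eq; exists (ocap V W).
have lV := @ocapl _ V W; have rW := @ocapr _ V W.
have c : ocap V W `<=` ocap (pg_dom (pg_of (germ Ux a)))
                            (pg_dom (pg_of (germ Ux b))).
  by move=> y [Vy Wy]; exact: conj (V1 y Vy) (W1 y Wy).
exists c, (subset_trans lV V2); split=> //.
rewrite !opE !(rres_comp O _ c (subset_trans lV V1)).
rewrite !(rres_comp O _ c (subset_trans rW W1)).
rewrite -(rres_comp O V1 lV) E (rres_comp O _ _ (subset_trans lV V2)).
by rewrite -(rres_comp O W1 rW) F (rres_comp O _ _ (subset_trans lV V2)).
Qed.

Definition germ_add := germ_op2 (fun U => +%R).
Definition germ_mul := germ_op2 (fun U => *%R).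
Definition germ_opp (s : stalk) : stalk :=
  germ_mul (germ (U := ofull X) I (-1)) s.

Lemma germ_addE U (Ux : oset U x) a b :
  germ_add (germ Ux a) (germ Ux b) = germ Ux (a + b).
Proof. by rewrite [LHS]germ_op2E// => *; rewrite rmorphD. Qed.

Lemma germ_mulE U (Ux : oset U x) a b :
  germ_mul (germ Ux a) (germ Ux b) = germ Ux (a * b).
Proof. by rewrite [LHS]germ_op2E// => *; rewrite rmorphM. Qed.

Lemma germ_full U (Ux : oset U x) (z : forall V, O V) :
  (forall (V : opens X) (VU : V `<=` ofull X), rres O VU (z (ofull X)) = z V) ->
  germ (U := ofull X) I (z (ofull X)) = germ Ux (z U).
Proof.
move=> zE; have UT : U `<=` ofull X by [].
rewrite -(zE U UT); exact/esym/germ_res.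
Qed.

Lemma germ_oppE U (Ux : oset U x) a : germ_opp (germ Ux a) = germ Ux (- a).
Proof.
rewrite /germ_opp (germ_full Ux (z := fun V => -1)); last first.
  by move=> V VU; rewrite rmorphN1.
by rewrite germ_mulE mulN1r.
Qed.

Lemma germ_ex3 (s t u : stalk) : exists U (Ux : oset U x) a b c,
  [/\ s = germ Ux a, t = germ Ux b & u = germ Ux c].
Proof.
have [U [Ux [a ->]]] := germ_ex s.
have [V [Vx [b ->]]] := germ_ex t.
have [W [Wx [c ->]]] := germ_ex u.
have sU : ocap (ocap U V) W `<=` U by move=> y [[]].
have sV : ocap (ocap U V) W `<=` V by move=> y [[]].
have sW : ocap (ocap U V) W `<=` W by move=> y [].
exists (ocap (ocap U V) W), (conj (conj Ux Vx) Wx).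
by exists (rres O sU a), (rres O sV b), (rres O sW c); split; apply/esym/germ_res.
Qed.

Definition germ_zero : stalk := germ (U := ofull X) I 0.
Definition germ_one : stalk := germ (U := ofull X) I 1.

Lemma germ_zeroE U (Ux : oset U x) : germ_zero = germ Ux 0.
Proof. by apply: (germ_full Ux (z := fun=> 0)) => *; rewrite rmorph0. Qed.

Lemma germ_oneE U (Ux : oset U x) : germ_one = germ Ux 1.
Proof. by apply: (germ_full Ux (z := fun=> 1)) => *; rewrite rmorph1. Qed.

Lemma germ_addA : associative germ_add.
Proof.
move=> s t u; have [U [Ux [a [b [c [-> -> ->]]]]]] := germ_ex3 s t u.
by rewrite !germ_addE addrA.
Qed.

Lemma germ_addC : commutative germ_add.
Proof.
move=> s t; have [U [Ux [a [b [c [-> -> _]]]]]] := germ_ex3 s t t.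
by rewrite !germ_addE addrC.
Qed.

Lemma germ_add0 : left_id germ_zero germ_add.
Proof.
move=> s; have [U [Ux [a ->]]] := germ_ex s.
by rewrite (germ_zeroE Ux) germ_addE add0r.
Qed.

Lemma germ_addN : left_inverse germ_zero germ_opp germ_add.
Proof.
move=> s; have [U [Ux [a ->]]] := germ_ex s.
by rewrite (germ_zeroE Ux) germ_oppE germ_addE addNr.
Qed.

Lemma germ_mulA : associative germ_mul.
Proof.
move=> s t u; have [U [Ux [a [b [c [-> -> ->]]]]]] := germ_ex3 s t u.
by rewrite !germ_mulE mulrA.
Qed.

Lemma germ_mulC : commutative germ_mul.
Proof.
move=> s t; have [U [Ux [a [b [c [-> -> _]]]]]] := germ_ex3 s t t.
by rewrite !germ_mulE mulrC.
Qed.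

Lemma germ_mul1 : left_id germ_one germ_mul.
Proof.
move=> s; have [U [Ux [a ->]]] := germ_ex s.
by rewrite (germ_oneE Ux) germ_mulE mul1r.
Qed.

Lemma germ_mulDl : left_distributive germ_mul germ_add.
Proof.
move=> s t u; have [U [Ux [a [b [c [-> -> ->]]]]]] := germ_ex3 s t u.
by rewrite !(germ_addE, germ_mulE) mulrDl.
Qed.

HB.instance Definition _ :=
  GRing.isZmodule.Build stalk germ_addA germ_addC germ_add0 germ_addN.
HB.instance Definition _ :=
  GRing.Zmodule_isComPzRing.Build stalk germ_mulA germ_mulC germ_mul1 germ_mulDl.

Section GermMorphism.
Variables (U : opens X) (Ux : oset U x).

Lemma germ_is_zmod_morphism : zmod_morphism (germ Ux).
Proof.
move=> a b; apply: (addIr (germ Ux b)); rewrite subrK.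
by rewrite [LHS]germ_addE subrK.
Qed.

Lemma germ_is_monoid_morphism : monoid_morphism (germ Ux).
Proof.
by split=> [|a b]; rewrite -?germ_oneE// -germ_mulE.
Qed.

HB.instance Definition _ :=
  GRing.isZmodMorphism.Build (O U) stalk (germ Ux) germ_is_zmod_morphism.
HB.instance Definition _ :=
  GRing.isMonoidMorphism.Build (O U) stalk (germ Ux) germ_is_monoid_morphism.

End GermMorphism.

End Stalk.

Section PrimeIdeals.
Variable A : comPzRingType.

Definition prime_ideal (p : set A) : Prop :=
  [/\ p 0, (forall a b, p a -> p b -> p (a + b)),
      (forall a b, p b -> p (a * b)), ~ p 1 &
      forall a b, p (a * b) -> p a \/ p b].

Definition is_unit (a : A) : Prop := exists b, a * b = 1.

End PrimeIdeals.

(* phi : A -> B exhibits B as the localization A_f. *)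
Definition localizes_away (A B : comPzRingType) (f : A)
    (phi : A -> B) : Prop :=
  [/\ is_unit (phi f),
      (forall b, exists a n, phi f ^+ n * b = phi a) &
      forall a, phi a = 0 -> exists n, f ^+ n * a = 0].

(* (U, O|U) is isomorphic to Spec A: pt is a homeomorphism from U onto the set
   of prime ideals of A with the Zariski topology (the opens are the complements
   of the sets V(J)), and phi induces O(D(f)) = A_f for all f in A, compatibly
   with restriction; the structure sheaf of Spec A is determined by this on the
   basis of the D(f). *)
Definition affine_open (X : topologicalType) (O : ring_sheaf X) (U : opens X) :
    Prop :=
  exists (A : comPzRingType) (phi : {rmorphism A -> O U}) (pt : X -> set A),
    [/\ (forall x, oset U x -> prime_ideal (pt x)),
        (forall x y, oset U x -> oset U y -> pt x = pt y -> x = y),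
        (forall p, prime_ideal p -> exists x, oset U x /\ pt x = p),
        (forall W : set X, W `<=` U ->
          (open W <->
           exists J : set A, forall x, oset U x -> (W x <-> ~ (J `<=` pt x)))) &
        forall (f : A) (V : opens X) (VU : V `<=` U),
          (forall x, oset V x <-> oset U x /\ ~ pt x f) ->
          localizes_away f (fun a => rres O VU (phi a))].

(* A scheme over K: the structure morphism to Spec K is given by the ring
   morphism K -> Gamma(X, O_X). *)
Record scheme (K : fieldType) := Scheme {
  sch_top :> topologicalType;
  sch_sheaf : ring_sheaf sch_top;
  sch_affine : forall x, exists U : opens sch_top,
    oset U x /\ affine_open sch_sheaf U;
  sch_str : {rmorphism K -> sch_sheaf (ofull sch_top)} }.

Section DependentProductRing.
Variables (I : Type) (R : I -> pzRingType).

Definition dfam : Type := forall i, R i.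

HB.instance Definition _ := gen_eqMixin dfam.
HB.instance Definition _ := gen_choiceMixin dfam.

Implicit Types s t u : dfam.

Definition dfam_zero : dfam := fun=> 0.
Definition dfam_one : dfam := fun=> 1.
Definition dfam_add s t : dfam := fun i => s i + t i.
Definition dfam_opp s : dfam := fun i => - s i.
Definition dfam_mul s t : dfam := fun i => s i * t i.

Lemma dfamP s t : (forall i, s i = t i) -> s = t.
Proof. exact: functional_extensionality_dep. Qed.

Lemma dfam_addA : associative dfam_add.
Proof. by move=> s t u; apply/dfamP => i; exact: addrA. Qed.

Lemma dfam_addC : commutative dfam_add.
Proof. by move=> s t; apply/dfamP => i; exact: addrC. Qed.

Lemma dfam_add0 : left_id dfam_zero dfam_add.
Proof. by move=> s; apply/dfamP => i; exact: add0r. Qed.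

Lemma dfam_addN : left_inverse dfam_zero dfam_opp dfam_add.
Proof. by move=> s; apply/dfamP => i; exact: addNr. Qed.

Lemma dfam_mulA : associative dfam_mul.
Proof. by move=> s t u; apply/dfamP => i; exact: mulrA. Qed.

Lemma dfam_mul1 : left_id dfam_one dfam_mul.
Proof. by move=> s; apply/dfamP => i; exact: mul1r. Qed.

Lemma dfam_1mul : right_id dfam_one dfam_mul.
Proof. by move=> s; apply/dfamP => i; exact: mulr1. Qed.

Lemma dfam_mulDl : left_distributive dfam_mul dfam_add.
Proof. by move=> s t u; apply/dfamP => i; exact: mulrDl. Qed.

Lemma dfam_mulDr : right_distributive dfam_mul dfam_add.
Proof. by move=> s t u; apply/dfamP => i; exact: mulrDr. Qed.

HB.instance Definition _ :=
  GRing.isZmodule.Build dfam dfam_addA dfam_addC dfam_add0 dfam_addN.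
HB.instance Definition _ :=
  GRing.Zmodule_isPzRing.Build dfam dfam_mulA dfam_mul1 dfam_1mul
    dfam_mulDl dfam_mulDr.

Lemma dfamDE s t i : (s + t) i = s i + t i. Proof. by []. Qed.
Lemma dfamNE s i : (- s) i = - s i. Proof. by []. Qed.
Lemma dfamME s t i : (s * t) i = s i * t i. Proof. by []. Qed.
Lemma dfam0E i : (0 : dfam) i = 0. Proof. by []. Qed.
Lemma dfam1E i : (1 : dfam) i = 1. Proof. by []. Qed.

End DependentProductRing.

Section Forms.
Variables (K : fieldType) (X : scheme K).

Local Notation O := (sch_sheaf X).

Lemma sub_ofull (U : opens X) : U `<=` ofull X. Proof. by []. Qed.

Definition scal (U : opens X) : {rmorphism K -> O U} :=
  rres O (sub_ofull (U := U)) \o sch_str X.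

Definition scal_stalk (x : X) : {rmorphism K -> stalk O x} :=
  germ (U := ofull X) I \o sch_str X.

Lemma rres_scal (U V : opens X) (VU : V `<=` U) c :
  rres O VU (scal U c) = scal V c.
Proof. exact: rres_comp. Qed.

Lemma germ_scal (U : opens X) x (Ux : oset U x) c :
  germ Ux (scal U c) = scal_stalk x c.
Proof. exact: germ_res. Qed.

(* The presheaf of exterior algebras of Kaehler differentials, and the stalks
   of its associated sheaf. *)
Definition pform (U : opens X) := exterior (kaehler (scal U)).
Definition sform (x : X) := exterior (kaehler (scal_stalk x)).

Definition pres (U V : opens X) (VU : V `<=` U) : pform U -> pform V :=
  emap (KAlgMor (rres_scal VU)).
Definition pgerm (U : opens X) (x : X) (Ux : oset U x) : pform U -> sform x :=
  emap (KAlgMor (germ_scal Ux)).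

HB.instance Definition _ U := GRing.PzRing.on (pform U).
HB.instance Definition _ x := GRing.PzRing.on (sform x).
HB.instance Definition _ U V VU := GRing.RMorphism.on (@pres U V VU).
HB.instance Definition _ U x Ux := GRing.RMorphism.on (@pgerm U x Ux).

Lemma pgerm_res (U V : opens X) (VU : V `<=` U) x (Ux : oset U x)
    (Vx : oset V x) w : pgerm Vx (pres VU w) = pgerm Ux w.
Proof. by apply: emap_comp => a; exact: germ_res. Qed.

Section Sections.
Variable U : opens X.

Definition germs : Type := dfam (fun x : {x | oset U x} => sform (sval x)).
HB.instance Definition _ := GRing.PzRing.on germs.

(* The sections over U of the sheaf associated with pform: the families of
   germs which are locally induced by sections of pform. *)
Definition locally_in (P : forall V : opens X, pform V -> Prop) (s : germs) :
    Prop :=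
  forall x, oset U x -> exists (V : opens X) (VU : V `<=` U) (w : pform V),
    [/\ oset V x, P V w &
        forall y (Vy : oset V y), s (exist _ y (VU y Vy)) = pgerm Vy w].

Lemma locally_in2 (P : forall V : opens X, pform V -> Prop)
    (op : forall V, pform V -> pform V -> pform V)
    (sop : germs -> germs -> germs) (s t : germs) :
  (forall (V W : opens X) (WV : W `<=` V) w, P V w -> P W (pres WV w)) ->
  (forall V w v, P V w -> P V v -> P V (op V w v)) ->
  (forall (V : opens X) (VU : V `<=` U) w v,
    (forall y (Vy : oset V y), s (exist _ y (VU y Vy)) = pgerm Vy w) ->
    (forall y (Vy : oset V y), t (exist _ y (VU y Vy)) = pgerm Vy v) ->
    forall y (Vy : oset V y),
      sop s t (exist _ y (VU y Vy)) = pgerm Vy (op V w v)) ->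
  locally_in P s -> locally_in P t -> locally_in P (sop s t).
Proof.
move=> Pres Pop opE ls lt x Ux.
have [V [VU [w [Vx Pw sE]]]] := ls x Ux.
have [W [WU [v [Wx Pv tE]]]] := lt x Ux.
have lV := @ocapl _ V W; have rW := @ocapr _ V W.
exists (ocap V W), (subset_trans lV VU), (op _ (pres lV w) (pres rW v)).
split=> //; first by apply: Pop; exact: Pres.
apply: opE => y VWy.
  by rewrite (pgerm_res lV (lV y VWy)) -sE; congr (s (exist _ y _)).
by rewrite (pgerm_res rW (rW y VWy)) -tE; congr (t (exist _ y _)).
Qed.

Definition is_form : pred germs :=
  fun s => `[< locally_in (fun _ _ => True) s >].

Lemma is_form_subring : subring_closed is_form.
Proof.
split.
- apply/asboolP => x Ux; exists U, (@subset_refl _ _), 1; split=> // y Uy.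
  by rewrite rmorph1.
- move=> s t /asboolP ls /asboolP lt; apply/asboolP.
  apply: (@locally_in2 _ (fun V w v => w - v) (fun s t => s - t)) ls lt => //.
  by move=> V VU w v sE tE y Vy; rewrite raddfB /= -sE -tE.
- move=> s t /asboolP ls /asboolP lt; apply/asboolP.
  apply: (@locally_in2 _ (fun V w v => w * v) (fun s t => s * t)) ls lt => //.
  by move=> V VU w v sE tE y Vy; rewrite rmorphM /= -sE -tE.
Qed.

HB.instance Definition _ := GRing.isSubringClosed.Build germs is_form
  is_form_subring.

(* Gamma(U, Omega), Omega the sum of the Omega^k: all differential forms on U. *)
Record dform := DForm { form_val :> germs; formP : is_form form_val }.
HB.instance Definition _ := [isSub for form_val].
HB.instance Definition _ := [Choice of dform by <:].
HB.instance Definition _ := GRing.SubChoice_isSubPzRing.Build germs is_form dform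
  (subringClosedP _).

End Sections.
End Forms.

Section FormOperations.
Variables (K : fieldType) (X : scheme K).

Local Notation O := (sch_sheaf X).

Section OnOpen.
Variable U : opens X.

Lemma form_of_subproof (w : pform U) :
  is_form ((fun x => pgerm (svalP x) w) : germs U).
Proof.
apply/asboolP => x Ux; exists U, (@subset_refl _ _), w; split=> // y Uy /=.
by congr (pgerm _ w); exact: Prop_irrelevance.
Qed.

(* The canonical map from the presheaf to the associated sheaf. *)
Definition form_of (w : pform U) : dform U := DForm (form_of_subproof w).

Lemma form_of_is_zmod_morphism : zmod_morphism form_of.
Proof.
by move=> v w; apply/val_inj/dfamP => x /=; rewrite raddfB.
Qed.

Lemma form_of_is_monoid_morphism : monoid_morphism form_of.
Proof.
by split=> [|v w]; apply/val_inj/dfamP => x /=; rewrite ?rmorph1 ?rmorphM.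
Qed.

HB.instance Definition _ := GRing.isZmodMorphism.Build (pform U) (dform U)
  form_of form_of_is_zmod_morphism.
HB.instance Definition _ := GRing.isMonoidMorphism.Build (pform U) (dform U)
  form_of form_of_is_monoid_morphism.

Definition fn_form (a : O U) : dform U := form_of (ecst _ a).
Definition cst_form (c : K) : dform U := fn_form (scal U c).

Lemma formd_subproof (s : dform U) :
  is_form ((fun x => ed (form_val s x)) : germs U).
Proof.
apply/asboolP => x Ux; have /asboolP/(_ x Ux)[V [VU [w [Vx _ sE]]]] := formP s.
exists V, VU, (ed w); split=> // y Vy.
by rewrite /= sE /pgerm emap_ed.
Qed.

Definition formd (s : dform U) : dform U := DForm (formd_subproof s).

Lemma formd_is_zmod_morphism : zmod_morphism formd.
Proof. by move=> s t; apply/val_inj/dfamP => x; exact: raddfB. Qed.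

HB.instance Definition _ := GRing.isZmodMorphism.Build (dform U) (dform U)
  formd formd_is_zmod_morphism.

(* Gamma(U, Omega^k). *)
Definition is_kform (k : nat) (s : dform U) : Prop :=
  locally_in (fun V w => ext_pow k w) s.

Definition is_closed_kform (k : nat) : pred (dform U) :=
  fun s => `[< is_kform k s /\ formd s = 0 >].

End OnOpen.

Lemma form_res_subproof (U V : opens X) (VU : V `<=` U) (s : dform U) :
  is_form ((fun x => form_val s (exist _ (sval x) (VU _ (svalP x)))) : germs V).
Proof.
apply/asboolP => x Vx.
have /asboolP/(_ x (VU x Vx))[W [WU [w [Wx _ sE]]]] := formP s.
have lV := @ocapl _ V W; have rW := @ocapr _ V W.
exists (ocap V W), lV, (pres rW w); split=> // y VWy.
rewrite (pgerm_res rW (rW y VWy)) -sE /=.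
by congr (form_val s (exist _ y _)); exact: Prop_irrelevance.
Qed.

Definition form_res (U V : opens X) (VU : V `<=` U) (s : dform U) : dform V :=
  DForm (form_res_subproof VU s).

Section Restriction.
Variables (U V : opens X) (VU : V `<=` U).

Lemma form_res_is_zmod_morphism : zmod_morphism (form_res VU).
Proof. by move=> s t; apply/val_inj/dfamP. Qed.

Lemma form_res_is_monoid_morphism : monoid_morphism (form_res VU).
Proof. by split=> [|s t]; apply/val_inj/dfamP. Qed.

HB.instance Definition _ := GRing.isZmodMorphism.Build (dform U) (dform V)
  (form_res VU) form_res_is_zmod_morphism.
HB.instance Definition _ := GRing.isMonoidMorphism.Build (dform U) (dform V)
  (form_res VU) form_res_is_monoid_morphism.

Lemma form_res_kform k s : is_kform k s -> is_kform k (form_res VU s).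
Proof.
move=> sk x Vx; have [W [WU [w [Wx wk sE]]]] := sk x (@VU x Vx).
have lV := @ocapl _ V W; have rW := @ocapr _ V W.
exists (ocap V W), lV, (pres rW w); split=> //; first exact: emap_ext_pow.
move=> y VWy; rewrite (pgerm_res rW (rW y VWy)) -sE /=.
by congr (form_val s (exist _ y _)); exact: Prop_irrelevance.
Qed.

Lemma formd_res s : formd (form_res VU s) = form_res VU (formd s).
Proof. exact: val_inj. Qed.

End Restriction.

Lemma ext_powB (A : comPzRingType) (N : lmodType A) k (v w : exterior N) :
  ext_pow k v -> ext_pow k w -> ext_pow k (v - w).
Proof.
move=> [p [a [m ->]]] [q [b [n ->]]].
exists (p + q)%N,
  (fun j => match fintype.split j with inl j => a j | inr j => - b j end),
  (fun j => match fintype.split j with inl j => m j | inr j => n j end).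
rewrite big_split_ord /=; congr (_ + _).
  by apply: eq_bigr => j _; rewrite (unsplitK (inl j)).
rewrite -sumrN; apply: eq_bigr => j _.
by rewrite (unsplitK (inr j)) rmorphN mulNr.
Qed.

Lemma ext_pow0 (A : comPzRingType) (N : lmodType A) k :
  ext_pow k (0 : exterior N).
Proof. by exists 0, (fun=> 0), (fun _ _ => 0); rewrite big_ord0. Qed.

Section ClosedForms.
Variable k : nat.

Lemma is_closed_kform_zmod U : zmod_closed (is_closed_kform (U := U) k).
Proof.
split.
  apply/asboolP; split; last by rewrite raddf0.
  move=> x Ux; exists U, (@subset_refl _ _), 0; split=> //.
    exact: ext_pow0.
  by move=> y Uy; rewrite raddf0.
move=> s t /asboolP[sk ds] /asboolP[tk dt]; apply/asboolP; split; last first.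
  by rewrite raddfB /= ds dt subr0.
apply: (@locally_in2 _ _ _ (fun V w => ext_pow k w) (fun V w v => w - v)
  (fun s t => s - t)) sk tk => [||V VU w v sE tE y Vy].
- by move=> V W WV w; exact: emap_ext_pow.
- by move=> V w v; exact: ext_powB.
- by rewrite raddfB /= -sE -tE.
Qed.

(* Gamma(U, d Omega^(k-1)): the closed k-forms on U. *)
Record closed_form (U : opens X) := ClosedForm {
  cform_val :> dform U;
  cformP : is_closed_kform k cform_val }.

Section Instances.
Variable U : opens X.
HB.instance Definition _ := [isSub for @cform_val U].
HB.instance Definition _ := [Choice of closed_form U by <:].
HB.instance Definition _ := GRing.SubChoice_isSubZmodule.Build (dform U)
  (is_closed_kform k) (closed_form U) (@is_closed_kform_zmod U).
End Instances.

Lemma cform_res_subproof (U V : opens X) (VU : V `<=` U) (s : closed_form U) :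
  is_closed_kform k (form_res VU s).
Proof.
have /asboolP[sk ds] := cformP s; apply/asboolP; split.
  exact: form_res_kform.
by rewrite formd_res ds raddf0.
Qed.

Definition cform_res (U V : opens X) (VU : V `<=` U) (s : closed_form U) :
    closed_form V :=
  ClosedForm (cform_res_subproof VU s).

Lemma cform_res_is_zmod_morphism (U V : opens X) (VU : V `<=` U) :
  zmod_morphism (cform_res VU).
Proof. by move=> s t; apply/val_inj; exact: (raddfB (form_res VU)). Qed.

HB.instance Definition _ (U V : opens X) (VU : V `<=` U) :=
  GRing.isZmodMorphism.Build (closed_form U) (closed_form V)
    (cform_res VU) (cform_res_is_zmod_morphism VU).

End ClosedForms.
End FormOperations.

Record ab_presheaf (X : topologicalType) := AbPresheaf {
  asec :> opens X -> zmodType;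
  ares : forall U V : opens X, V `<=` U -> {additive asec U -> asec V};
  ares_id : forall (U : opens X) (UU : U `<=` U) a, ares UU a = a;
  ares_comp : forall (U V W : opens X) (VU : V `<=` U) (WV : W `<=` V)
    (WU : W `<=` U) a, ares WV (ares VU a) = ares WU a }.

Arguments ares {X} _ {U V} VU.

Section ClosedFormSheaf.
Variables (K : fieldType) (X : scheme K) (k : nat).

Lemma cform_res_id (U : opens X) (UU : U `<=` U) (a : closed_form k U) :
  cform_res UU a = a.
Proof.
apply/val_inj/val_inj/dfamP => -[x Ux] /=.
by congr (form_val _ (exist _ x _)); exact: Prop_irrelevance.
Qed.

Lemma cform_res_comp (U V W : opens X) (VU : V `<=` U) (WV : W `<=` V)
    (WU : W `<=` U) (a : closed_form k U) :
  cform_res WV (cform_res VU a) = cform_res WU a.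
Proof.
apply/val_inj/val_inj/dfamP => -[x Wx] /=.
by congr (form_val _ (exist _ x _)); exact: Prop_irrelevance.
Qed.

(* The sheaf d Omega^(k-1). *)
Definition closed_forms : ab_presheaf X :=
  @AbPresheaf X (fun U => closed_form k U)
    (fun U V VU => @cform_res K X k U V VU) cform_res_id cform_res_comp.

End ClosedFormSheaf.

Record open_cover (X : topologicalType) := Cover {
  cov_disp : Order.disp_t;
  cov_idx : orderType cov_disp;
  cov_set :> cov_idx -> opens X;
  cov_covers : forall x, exists i, oset (cov_set i) x }.

Section Cech.
Variables (X : topologicalType) (F : ab_presheaf X).

Definition increasing d (I : orderType d) n (i : 'I_n -> I) : bool :=
  [forall a : 'I_n, forall b : 'I_n, (a < b)%N ==> (i a < i b)%O].

Lemma increasing_lift d (I : orderType d) n (i : 'I_n.+1 -> I) (j : 'I_n.+1) :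
  increasing i -> increasing (i \o lift j).
Proof.
move=> /forallP H; apply/forallP => a; apply/forallP => b; apply/implyP => ab.
have /forallP/(_ (lift j b))/implyP := H (lift j a); apply.
rewrite /= /bump; case: (leqP j a) => ja; case: (leqP j b) => jb //=.
- by rewrite ltnNge (leq_trans ja (ltnW ab)) in jb.
- by rewrite add0n add1n ltnS ltnW.
Qed.

Section Cochains.
Variable U : open_cover X.

(* Families (s_(i_0 ... i_n)) indexed by i_0 < ... < i_n. *)
Definition cochain (n : nat) : Type :=
  forall i : 'I_n.+1 -> cov_idx U, increasing i -> F (obigcap (U \o i)).

Definition cech_diff n (s : cochain n) : cochain n.+1 := fun i i_incr =>
  \sum_(j < n.+2)
    ares F (@obigcap_reindex X _ _ (U \o i) (lift j))
      (s (i \o lift j) (increasing_lift j i_incr)) *~ (-1) ^+ j.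

Definition is_coboundary n : cochain n -> Prop :=
  match n with
  | 0 => fun s => forall i i_incr, s i i_incr = 0
  | m.+1 => fun s => exists b : cochain m,
      forall i i_incr, s i i_incr = cech_diff b i_incr
  end.

Record cocycle (n : nat) := Cocycle {
  cocycle_val :> cochain n;
  cocycleP : forall i i_incr, cech_diff cocycle_val (i := i) i_incr = 0 }.

End Cochains.

Section Pullback.
Variables (U V : open_cover X) (r : cov_idx V -> cov_idx U).
Hypothesis rP : forall j, V j `<=` U (r j).

Lemma refine_perm n (j : 'I_n -> cov_idx V) (s : 'S_n) :
  obigcap (V \o j) `<=` obigcap (U \o (r \o j \o s)).
Proof. by move=> x Vx a; exact/rP/Vx. Qed.

(* (r^* c)_(j_0 ... j_n) = c_(r j_0 ... r j_n), where c is extended to all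
   index families as an alternating cochain: at most one s sorts r \o j, and
   none does when r j_0, ..., r j_n are not distinct. *)
Definition cech_pullback n (c : cochain U n) : cochain V n := fun j _ =>
  \sum_(s : 'S_n.+1)
    match @idP (increasing (r \o j \o s)) with
    | ReflectT h => ares F (@refine_perm _ j s) (c _ h) *~ (-1) ^+ s
    | ReflectF _ => 0
    end.

End Pullback.

Section Limit.
Variable n : nat.

Definition cech_rep : Type := {U : open_cover X & cocycle U n}.

(* z' on a refinement of the cover of z represents the image of the class
   of z; for the identity refinement, z and z' are cohomologous. *)
Definition cech_step (z z' : cech_rep) : Prop :=
  let c : cocycle (tag z) n := tagged z in
  let c' : cocycle (tag z') n := tagged z' in
  exists (r : cov_idx (tag z') -> cov_idx (tag z))
         (rP : forall j, tag z' j `<=` tag z (r j)),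
    is_coboundary (fun j j_incr =>
      cocycle_val c' j_incr - cech_pullback rP c j_incr).

Definition cech_equiv : cech_rep -> cech_rep -> Prop :=
  clos_refl_sym_trans cech_rep cech_step.

(* The direct limit of the groups H^n(U, F) under refinement. *)
Definition cech_cohomology : Type :=
  {C : cech_rep -> Prop | exists z, C = cech_equiv z}.

Definition cech_class (U : open_cover X) (z : cocycle U n) : cech_cohomology :=
  let z0 := existT (fun U => cocycle U n) U z in
  exist _ (cech_equiv z0) (ex_intro _ z0 erefl).

End Limit.
End Cech.

Section ModuleSheaves.
Variables (X : topologicalType) (O : ring_sheaf X).

Record mod_sheaf := ModSheaf {
  msec :> forall U : opens X, lmodType (O U);
  mres : forall U V : opens X, V `<=` U -> msec U -> msec V;
  mres_linear : forall (U V : opens X) (VU : V `<=` U) a s t,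
    mres VU (a *: s + t) = rres O VU a *: mres VU s + mres VU t;
  mres_id : forall (U : opens X) (UU : U `<=` U) s, mres UU s = s;
  mres_comp : forall (U V W : opens X) (VU : V `<=` U) (WV : W `<=` V)
    (WU : W `<=` U) s, mres WV (mres VU s) = mres WU s;
  mres_sheaf : is_sheaf mres }.

Variable E : mod_sheaf.

Record subsheaf := Subsheaf {
  ssec :> forall U : opens X, set (E U);
  ssec0 : forall U, @ssec U 0;
  ssec_linear : forall U a s t,
    @ssec U s -> @ssec U t -> @ssec U (a *: s + t);
  ssec_res : forall (U V : opens X) (VU : V `<=` U) s,
    @ssec U s -> @ssec V (mres VU s);
  ssec_local : forall U s,
    (forall x, oset U x -> exists (V : opens X) (VU : V `<=` U),
      oset V x /\ @ssec V (mres VU s)) -> @ssec U s }.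

Arguments ssec : clear implicits.

Definition full_subsheaf : subsheaf :=
  @Subsheaf (fun U => setT) (fun _ => I) (fun _ _ _ _ _ _ => I)
    (fun _ _ _ _ _ => I) (fun _ _ _ => I).

(* b is an isomorphism from O^n to S over V. *)
Definition is_free_basis (n : nat) (S : subsheaf) (V : opens X)
    (b : forall W : opens X, W `<=` V -> {linear 'cV[O W]_n -> E W}) : Prop :=
  [/\ (forall (W W' : opens X) (WV : W `<=` V) (W'V : W' `<=` V)
         (W'W : W' `<=` W) v,
         mres W'W (b W WV v) = b W' W'V (map_mx (rres O W'W) v)),
      (forall (W : opens X) (WV : W `<=` V), injective (b W WV)) &
      forall (W : opens X) (WV : W `<=` V) s,
        S W s <-> exists v, b W WV v = s].

Definition locally_free_of_rank (n : nat) (S : subsheaf) : Prop :=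
  forall x, exists V : opens X, oset V x /\ exists b, @is_free_basis n S V b.

Definition locally_free (S : subsheaf) : Prop :=
  forall x, exists (V : opens X) (n : nat),
    oset V x /\ exists b, @is_free_basis n S V b.

(* q : S|V -> O|V is an epimorphism of sheaves with kernel S'|V, i.e. it induces
   an isomorphism (S/S')|V = O|V; the values of q outside S are irrelevant. *)
Definition is_quotient_iso (S S' : subsheaf) (V : opens X)
    (q : forall W : opens X, W `<=` V -> E W -> O W) : Prop :=
  [/\ (forall (W : opens X) (WV : W `<=` V) a s t, S W s -> S W t ->
         q W WV (a *: s + t) = a * q W WV s + q W WV t),
      (forall (W W' : opens X) (WV : W `<=` V) (W'V : W' `<=` V)
         (W'W : W' `<=` W) s, S W s ->
         q W' W'V (mres W'W s) = rres O W'W (q W WV s)),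
      (forall (W : opens X) (WV : W `<=` V) a x, oset W x ->
         exists (W' : opens X) (W'W : W' `<=` W) (W'V : W' `<=` V) s,
           [/\ oset W' x, S W' s & q W' W'V s = rres O W'W a]) &
      forall (W : opens X) (WV : W `<=` V) s, S W s ->
        (q W WV s = 0 <-> S' W s)].

Definition invertible_quotient (S S' : subsheaf) : Prop :=
  forall x, exists V : opens X,
    oset V x /\ exists q, @is_quotient_iso S S' V q.

Record full_flag (M : nat) := FullFlag {
  flag :> 'I_M.+1 -> subsheaf;
  flag_bot : forall U s, flag ord0 U s <-> s = 0;
  flag_top : forall U s, flag ord_max U s;
  flag_sub : forall (p : 'I_M) U s,
    flag (widen_ord (leqnSn M) p) U s -> flag (lift ord0 p) U s;
  flag_free : forall p, locally_free (flag p);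
  flag_inv : forall p : 'I_M,
    invertible_quotient (flag (lift ord0 p)) (flag (widen_ord (leqnSn M) p)) }.

(* phi : E|U -> O_U^M is an isomorphism mapping each E_p|U onto O_U^p (+) 0. *)
Definition adapted_trivialization (M : nat) (Fl : full_flag M) (U : opens X)
    (phi : forall W : opens X, W `<=` U -> {linear E W -> 'cV[O W]_M}) : Prop :=
  [/\ (forall (W W' : opens X) (WU : W `<=` U) (W'U : W' `<=` U)
         (W'W : W' `<=` W) s,
         phi W' W'U (mres W'W s) = map_mx (rres O W'W) (phi W WU s)),
      (forall (W : opens X) (WU : W `<=` U), bijective (phi W WU)) &
      forall (p : 'I_M.+1) (W : opens X) (WU : W `<=` U) s,
        Fl p W s <-> forall a : 'I_M, (p <= a)%N -> phi W WU s a 0 = 0].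

(* g_ij is the matrix of phi_i \o phi_j^-1, acting on column vectors. *)
Definition transition_system (M : nat) (Fl : full_flag M) (U : open_cover X)
    (g : forall i j, 'M[O (ocap (U i) (U j))]_M) : Prop :=
  exists phi : forall i (W : opens X), W `<=` U i -> {linear E W -> 'cV[O W]_M},
    (forall i, adapted_trivialization Fl (phi i)) /\
    forall i j (W : opens X) (Wi : W `<=` U i) (Wj : W `<=` U j)
      (Wij : W `<=` ocap (U i) (U j)) s,
      phi i W Wi s = map_mx (rres O Wij) (g i j) *m phi j W Wj s.

End ModuleSheaves.

(* The inverse of an invertible matrix. *)
Definition mxinv (R : comPzRingType) (n : nat) (A : 'M[R]_n) : 'M[R]_n :=
  xget A [set B | A *m B = 1%:M /\ B *m A = 1%:M].

Section TInvariant.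
Variables (K : fieldType) (X : scheme K) (M : nat) (U : open_cover X).
Variable g : forall i j, 'M[sch_sheaf X (ocap (U i) (U j))]_M.

(* g_ij^-1 dg_ij *)
Definition dlog (i j : cov_idx U) : 'M[dform (ocap (U i) (U j))]_M :=
  map_mx (@fn_form _ _ _) (mxinv (g i j)) *m
  map_mx (fun a => formd (fn_form a)) (g i j).

(* Restricted to U_(i_1 ... i_(k+1)); the coefficient is computed in K, where
   the library sets 0^-1 = 0. *)
Definition T_form (k : nat) (i : 'I_k.+1 -> cov_idx U) :
    dform (obigcap (U \o i)) :=
  \sum_(s : 'S_k.+1)
    cst_form _ ((-1) ^+ s / (k.+1)`!%:R) *
    \tr (\prod_(l < k)
           map_mx (form_res (@obigcap_cap X _ (U \o i)
                               (s (widen_ord (leqnSn k) l)) (s ord_max)))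
             (dlog (i (s (widen_ord (leqnSn k) l))) (i (s ord_max)))).

End TInvariant.

(* Main.v *)
Require Import Defs.
From Stdlib Require Import Relation_Operators.
From mathcomp Require Import all_boot all_order all_algebra perm.
From mathcomp Require Import all_classical topology_structure.

Set Implicit Arguments.
Unset Strict Implicit.
Unset Printing Implicit Defensive.

Import Order.TTheory GRing.Theory.
Local Open Scope ring_scope.

(* The matrices [g_ij] are upper triangular, so the trace only sees their
   diagonal entries: the (m, m) entry [a_ij] is the transition function of the
   line bundle [E_(m+1)/E_m], and the 1-forms [a_ij^-1 da_ij] form an additive
   cocycle, i.e. they are the differences [x_i - x_j] of 1-forms [x_i].  As
   1-forms square to zero, [prod_(l < k) (x_l - x_k)] is alternating and equals
   the cup product [prod_(l < k) (x_l - x_(l+1))].  So all the terms of the sum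
   over [S_(k+1)] agree, and up to the constant [(k+1)!/(k+1)!] (which is 0 in
   positive characteristic at most k+1) the cochain is a sum of cup products,
   which are closed Cech cocycles.  On a common refinement of two covers the
   1-forms coming from the two families of trivializations differ by the
   coboundary of globally defined closed 1-forms, and the prism operator of the
   cup product exhibits the difference of the two cocycles as a coboundary. *)

(** * Cup products of differences and the prism operator *)

Section CupProduct.
Variable R : pzRingType.

Definition cup n (x : 'I_n.+1 -> R) : R :=
  \prod_(l < n) (x (widen_ord (leqnSn n) l) - x (lift ord0 l)).

Definition tail n T (x : 'I_n.+1 -> T) : 'I_n -> T := x \o lift ord0.

(** Unfolded, this is the sum over i of (-1)^i times the [cup] of x_0, ..., x_i, y_i, ..., y_n: the
    prism operator of simplicial homotopy. *)
Fixpoint prism n : ('I_n.+1 -> R) -> ('I_n.+1 -> R) -> R :=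
  match n with
  | 0 => fun x y => x ord0 - y ord0
  | m.+1 => fun x y =>
      (x ord0 - y ord0) * cup y -
      (x ord0 - x (lift ord0 ord0)) * prism (tail x) (tail y)
  end.

Lemma cup0 (x : 'I_1 -> R) : cup x = 1.
Proof. exact: big_ord0. Qed.

Lemma cupS n (x : 'I_n.+2 -> R) :
  cup x = (x ord0 - x (lift ord0 ord0)) * cup (tail x).
Proof.
rewrite /cup big_ord_recl; congr (_ * _).
  by congr (x _ - _); apply: val_inj.
by apply: eq_bigr => l _; congr (x _ - _); apply: val_inj.
Qed.

Lemma shiftB (a b a' b' c : R) : a' = a + c -> b' = b + c -> a' - b' = a - b.
Proof. by move=> -> ->; rewrite opprD addrACA subrr addr0. Qed.

(** Only differences of the x_l occur. This later makes the choice of a reference trivialization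
    immaterial. *)
Lemma cup_shift n (x y : 'I_n.+1 -> R) c :
  (forall l, y l = x l + c) -> cup y = cup x.
Proof. by move=> E; apply: eq_bigr => l _; exact: shiftB. Qed.

Lemma prism_shift n (x y x' y' : 'I_n.+1 -> R) c :
  (forall l, x' l = x l + c) -> (forall l, y' l = y l + c) ->
  prism x' y' = prism x y.
Proof.
elim: n => [|n IH] in x y x' y' * => Ex Ey /=; first exact: shiftB.
rewrite (cup_shift Ey) (IH (tail x) (tail y)) //.
- by rewrite (shiftB (Ex _) (Ey _)) (shiftB (Ex _) (Ex _)).
- by move=> l; exact: Ex.
- by move=> l; exact: Ey.
Qed.

Lemma tail_lift0 n T (x : 'I_n.+2 -> T) (j : 'I_n.+1) :
  tail (x \o lift (lift ord0 j)) = tail x \o lift j.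
Proof.
by apply/funext => l; congr x; apply: val_inj; rewrite /= /bump /= ltnS addnCA.
Qed.

Lemma lift00 n T (x : 'I_n.+2 -> T) : x \o lift ord0 = tail x.
Proof. by []. Qed.

Lemma coboundary_recl n (f : 'I_n.+1 -> R) :
  \sum_(j < n.+1) (-1) ^+ j * f j =
  f ord0 - \sum_(j < n) (-1) ^+ j * f (lift ord0 j).
Proof.
rewrite big_ord_recl mul1r -sumrN; congr (_ + _); apply: eq_bigr => j _.
by rewrite /= /bump add1n exprS mulN1r mulNr.
Qed.

(** Omitting index 1 merges the first two factors, whereas omitting a later index keeps x_0 - x_1 in
    front; the inductions below rest on this distinction. *)
Lemma cup_lift1 n (x : 'I_n.+3 -> R) :
  cup (x \o lift (lift ord0 ord0)) =
  (x ord0 - tail x (lift ord0 ord0)) * cup (tail (tail x)).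
Proof.
rewrite cupS tail_lift0; congr ((x _ - x _) * _); exact: val_inj.
Qed.

Lemma cup_lift2 n (x : 'I_n.+3 -> R) (j : 'I_n.+1) :
  cup (x \o lift (lift ord0 (lift ord0 j))) =
  (x ord0 - x (lift ord0 ord0)) * cup (tail x \o lift (lift ord0 j)).
Proof.
rewrite cupS tail_lift0; congr ((x _ - x _) * _); exact: val_inj.
Qed.

Lemma prism_lift1 n (x y : 'I_n.+3 -> R) :
  prism (x \o lift (lift ord0 ord0)) (y \o lift (lift ord0 ord0)) =
  (x ord0 - y ord0) * cup (y \o lift (lift ord0 ord0)) -
  (x ord0 - tail x (lift ord0 ord0)) * prism (tail (tail x)) (tail (tail y)).
Proof.
rewrite /= !tail_lift0; congr ((x _ - y _) * _ - (x _ - x _) * _);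
  exact: val_inj.
Qed.

Lemma prism_lift2 n (x y : 'I_n.+3 -> R) (j : 'I_n.+1) :
  prism (x \o lift (lift ord0 (lift ord0 j)))
        (y \o lift (lift ord0 (lift ord0 j))) =
  (x ord0 - y ord0) * cup (y \o lift (lift ord0 (lift ord0 j))) -
  (x ord0 - x (lift ord0 ord0)) *
    prism (tail x \o lift (lift ord0 j)) (tail y \o lift (lift ord0 j)).
Proof.
rewrite [LHS]/= !tail_lift0; congr ((x _ - y _) * _ - (x _ - x _) * _);
  exact: val_inj.
Qed.

(** The faces from index 2 on share the left factor x_0 - x_1, and induction on [tail x] gives their
    sum. What remains is (x_1 - x_2) - (x_0 - x_2) + (x_0 - x_1) = 0 times [cup (tail (tail x))]. *)
Lemma cup_coboundary n (x : 'I_n.+2 -> R) :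
  \sum_(j < n.+2) (-1) ^+ j * cup (x \o lift j) = 0.
Proof.
elim: n x => [|n IH] x.
  by rewrite !coboundary_recl big_ord0 !cup0 subr0 subrr.
have := IH (tail x); rewrite coboundary_recl lift00 => /subr0_eq E.
rewrite 2!coboundary_recl lift00 cup_lift1.
under eq_bigr => j _ do rewrite cup_lift2 mulrA -commr_sign -mulrA.
rewrite -mulr_sumr -E cupS opprB -mulrBl -mulrDl.
by rewrite opprB addrCA !subrKA subrr mul0r.
Qed.

Lemma prism_coboundary n (x y : 'I_n.+2 -> R) :
  \sum_(j < n.+2) (-1) ^+ j * prism (x \o lift j) (y \o lift j) =
  cup y - cup x.
Proof.
elim: n x y => [|n IH] x y.
  rewrite !coboundary_recl big_ord0 subr0 !cupS !cup0 !mulr1 /=.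
  rewrite (_ : lift (lift ord0 ord0) ord0 = ord0); last exact: val_inj.
  set a := x _; set b := x _; set a' := y _; set b' := y _.
  by rewrite !opprB [in RHS]addrACA [b' + a]addrC [in RHS]addrACA.
(* The faces from index 2 on split into a part with [cup] of faces of y and a part with [prism] of
   faces of the tails; [F] and [E] evaluate these two sums. *)
have := IH (tail x) (tail y); rewrite coboundary_recl !lift00.
move=> /(canRL (subKr _)) E.
have := cup_coboundary y; rewrite 2!coboundary_recl !lift00.
move=> /subr0_eq /esym /(canRL (subKr _)) F.
rewrite 2!coboundary_recl !lift00 prism_lift1.
under eq_bigr => j _ do rewrite prism_lift2 mulrBr !mulrA -!commr_sign -!mulrA.
rewrite sumrB -!mulr_sumr E F.
rewrite [prism (tail x) _]/= (cupS x) (cupS y) -!/(tail _ _).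
set C := cup (tail y); set D := cup (tail x); set Q := cup (y \o _).
set J := prism _ _; set c := tail x (lift _ _).
rewrite -[tail x ord0]/(x (lift ord0 ord0)) -[tail y ord0]/(y (lift ord0 ord0)).
set a := x ord0; set b := x _; set a' := y ord0; set b' := y _.
(* The rest is a noncommutative ring identity: once a - c and a' - b' are written in the four
   differences generalized below, the expanded monomials cancel. *)
rewrite (_ : a - c = (a - b) + (b - c)); last by rewrite subrKA.
rewrite (_ : a' - b' = (b - b') - (a - a') + (a - b)); last first.
  by rewrite opprB -addrA subrKA addrC subrKA.
move: (a - b) (b - c) (a - a') (b - b') => w v u u'.
rewrite !mulrDl !mulrBr !mulNr.
move: (u' * C) (v * J) (u * Q) (u * C) (w * J) (w * C) (w * D).
move=> vC cJ uQ uC wJ wC wD.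
rewrite !opprB !addrA subrK.
by rewrite [LHS](ACl (1*4*5*6*(7*2)*(3*8))) /= !subrr !addr0.
Qed.

(** * Alternation of products of elements squaring to zero *)

Section Alternation.
Variable S : {pred R}.
Hypotheses (S_zmod : zmod_closed S) (S_sqr : forall u, u \in S -> u * u = 0).

Lemma sqr0_anti u v : u \in S -> v \in S -> u * v = - (v * u).
Proof.
move=> Su Sv; have [S0 SB] := S_zmod.
have /S_sqr : u - v \in S by exact: SB.
rewrite mulrBl !mulrBr (S_sqr Su) (S_sqr Sv) sub0r subr0 -opprD => /eqP.
by rewrite oppr_eq0 addr_eq0 => /eqP.
Qed.

Lemma sqr0_sandwich (I : Type) (s : seq I) (y : I -> R) u :
  u \in S -> (forall i, y i \in S) -> u * (\prod_(i <- s) y i) * u = 0.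
Proof.
move=> Su Sy; suff [e ->] : exists e, u * (\prod_(i <- s) y i) =
    (-1) ^+ e * (\prod_(i <- s) y i) * u.
  by rewrite -(mulrA _ u) (S_sqr Su) mulr0.
elim: s => [|i s [e IH]]; first by exists 0; rewrite big_nil mulr1 !mul1r.
exists e.+1; rewrite big_cons mulrA (sqr0_anti Su (Sy i)) mulNr -mulrA IH.
by rewrite exprS mulN1r !mulNr !mulrA -commr_sign.
Qed.

(** Every term of the expansion that picks -u from some factor contains u twice and vanishes by
    [sqr0_sandwich]. *)
Lemma sqr0_subl (I : Type) (s : seq I) (y : I -> R) u :
  u \in S -> (forall i, y i \in S) ->
  (\prod_(i <- s) (y i - u)) * u = (\prod_(i <- s) y i) * u.
Proof.
move=> Su Sy; elim: s => [|i s IH]; first by rewrite !big_nil.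
rewrite !big_cons -mulrA IH mulrBl [u * _]mulrA sqr0_sandwich // subr0.
by rewrite mulrA.
Qed.

Lemma sqr0_subr (I : Type) (s : seq I) (y : I -> R) u :
  u \in S -> (forall i, y i \in S) ->
  u * (\prod_(i <- s) (y i - u)) = u * (\prod_(i <- s) y i).
Proof.
move=> Su Sy; elim: s => [|i s IH]; first by rewrite !big_nil.
rewrite !big_cons mulrBl mulrBr [u * (u * _)]mulrA S_sqr // mul0r subr0.
by rewrite !mulrA (sqr0_anti Su (Sy i)) !mulNr -!mulrA IH.
Qed.

(** The shape of the products in [T_form], where every difference ends at the last index. *)
Definition starprod n (x : 'I_n.+1 -> R) : R :=
  \prod_(l < n) (x (widen_ord (leqnSn n) l) - x ord_max).

Lemma starprod_cup n (x : 'I_n.+1 -> R) :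
  (forall l, x l \in S) -> starprod x = cup x.
Proof.
have [S0 SB] := S_zmod.
elim: n x => [|n IH] x Sx; first by rewrite /starprod cup0 big_ord0.
have starS (m : nat) (z : 'I_m.+2 -> R) :
    starprod z = (z ord0 - z ord_max) * starprod (tail z).
  rewrite /starprod big_ord_recl; congr (_ * _).
    by congr (z _ - _); exact: val_inj.
  by apply: eq_bigr => l _; congr (z _ - z _); exact: val_inj.
rewrite starS cupS -IH; last by move=> l; exact: Sx.
(* Split x_0 - x_max at x_1: the second part is 0 if x_1 is the last entry, and otherwise meets the
   equal first factor of [starprod (tail x)], giving a square. *)
rewrite -[x ord0 - x ord_max](subrKA (x (lift ord0 ord0))) mulrDl.
rewrite [X in _ + X](_ : _ = 0) ?addr0 //.
case: n {IH} x Sx => [|n] x Sx.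
  by rewrite (_ : lift ord0 ord0 = ord_max) ?subrr ?mul0r //; exact: val_inj.
rewrite starS (_ : tail x ord_max = x ord_max); last by congr x; exact: val_inj.
by rewrite mulrA S_sqr ?mul0r // SB.
Qed.

(** With y_l = x_l - x_max, the exchange turns y_b into -y_b and every other y_l into y_l - y_b;
    next to y_b these corrections disappear by [sqr0_subl] and [sqr0_subr]. *)
Lemma starprod_tperm n (x : 'I_n.+1 -> R) (b : 'I_n) :
  (forall l, x l \in S) ->
  starprod (x \o tperm ord_max (widen_ord (leqnSn n) b)) = - starprod x.
Proof.
have [S0 SB] := S_zmod => Sx; set wb := widen_ord _ b.
pose y l := x (widen_ord (leqnSn n) l) - x ord_max.
have Sy l : y l \in S by exact: SB.
rewrite /starprod -[RHS]/(- \prod_(l < n) y l) /= tpermL.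
have [s1 [s2 Es]] : exists s1 s2, index_enum 'I_n = s1 ++ b :: s2.
  by case/splitPr: (mem_index_enum b) => s1 s2; exists s1, s2.
have := index_enum_uniq 'I_n; rewrite Es cat_uniq /= negb_or.
case/and4P=> _ /andP[b1 _] b2 _.
rewrite !big_cat !big_cons tpermR /=.
rewrite (_ : x ord_max - x wb = - y b); last by rewrite opprB.
have eqy s : b \notin s ->
    \prod_(l <- s) (x (tperm ord_max wb (widen_ord (leqnSn n) l)) - x wb) =
    \prod_(l <- s) (y l - y b).
  move=> bs; apply: eq_big_seq => l ls; rewrite tpermD.
  - by rewrite opprB addrC subrKA addrC.
  - by rewrite -val_eqE /= gtn_eqF.
  - by rewrite -val_eqE /=; apply: contraNneq bs => /val_inj ->.
rewrite !eqy // mulNr mulrN mulrA sqr0_subl // -!mulrA; congr (- (_ * _)).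
exact: sqr0_subr.
Qed.

(** Transpositions with the last index, covered by [starprod_tperm], generate the symmetric group:
    any other transposition is a conjugate of one of them by another. *)
Lemma cup_perm n (x : 'I_n.+1 -> R) (s : 'S_n.+1) :
  (forall l, x l \in S) -> cup (x \o s) = (-1) ^+ s * cup x.
Proof.
move=> Sx; rewrite -!starprod_cup // => [|l]; last exact: Sx.
pose alt (s : 'S_n.+1) := forall x : 'I_n.+1 -> R, (forall l, x l \in S) ->
  starprod (x \o s) = (-1) ^+ s * starprod x.
suff: alt s by apply.
have altM t u : alt t -> alt u -> alt (t * u)%g.
  move=> At Au z Sz; rewrite odd_permM signr_addb.
  rewrite (_ : z \o (t * u)%g = (z \o u) \o t) ?At ?Au ?mulrA //.
  - by move=> l; exact: Sz.
  - by apply/funext => l; rewrite /= permM.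
have alt_star b : b != ord_max -> alt (tperm ord_max b).
  move=> nb z Sz; rewrite odd_tperm eq_sym nb mulN1r.
  have lt_b : (b < n)%N by rewrite ltn_neqAle -ltnS ltn_ord andbT.
  rewrite -(starprod_tperm (Ordinal lt_b)) //.
  by congr (starprod (_ \o tperm _ _)); exact: val_inj.
have alt_tperm a b : a != b -> alt (tperm a b).
  have [->|na] := eqVneq a ord_max.
    by move=> nb; apply: alt_star; rewrite eq_sym.
  have [->|nb] := eqVneq b ord_max.
    by move=> _; rewrite tpermC; exact: alt_star.
  move=> nab; rewrite (_ : tperm a b =
    tperm ord_max a * tperm ord_max b * tperm ord_max a)%g.
    exact/(altM _ _ (altM _ _ (alt_star _ na) (alt_star _ nb)))/alt_star.
  have := tpermJ ord_max b (tperm ord_max a).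
  rewrite tpermL tpermD //; last by rewrite eq_sym.
  by rewrite /conjg tpermV => <-; rewrite mulgA.
have [ts -> /allP nts] := prod_tpermP s.
elim: ts nts => [|t ts IH] nts.
  rewrite big_nil => z Sz; rewrite odd_perm1 mul1r; congr starprod.
  by apply/funext => l /=; rewrite perm1.
rewrite big_cons; apply: altM; first exact/alt_tperm/nts/mem_head.
by apply: IH => u uts; apply: nts; rewrite inE uts orbT.
Qed.

(** Alternation alone would only give 2 * [cup x] = 0. Instead, b is moved to the last position, and
    the star product then has the factor x_a - x_max = 0. *)
Lemma cup_repeat n (x : 'I_n.+1 -> R) a b :
  (forall l, x l \in S) -> a != b -> x a = x b -> cup x = 0.
Proof.
have [S0 SB] := S_zmod.
wlog -> : x a b / b = ord_max => [H|] Sx nab xab.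
  have -> : cup x = (-1) ^+ tperm b ord_max * cup (x \o tperm b ord_max).
    by rewrite cup_perm // signrMK.
  rewrite (H _ (tperm b ord_max a) ord_max) ?mulr0 //.
  - by move=> l; exact: Sx.
  - by rewrite -[X in _ != X](tpermL b) (inj_eq perm_inj).
  - by rewrite /= tpermK tpermR.
have lt_a : (a < n)%N by rewrite ltn_neqAle -ltnS ltn_ord andbT.
rewrite -starprod_cup // /starprod.
have [s1 [s2 ->]] : exists s1 s2, index_enum 'I_n = s1 ++ Ordinal lt_a :: s2.
  by case/splitPr: (mem_index_enum (Ordinal lt_a)) => s1 s2; exists s1, s2.
rewrite big_cat big_cons /= (_ : widen_ord _ _ = a); last exact: val_inj.
by rewrite xab subrr mul0r mulr0.
Qed.

End Alternation.
End CupProduct.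

Lemma rmorph_cup (R R' : pzRingType) (f : {rmorphism R -> R'}) n
    (x : 'I_n.+1 -> R) : f (cup x) = cup (f \o x).
Proof. by rewrite rmorph_prod; apply: eq_bigr => l _; rewrite rmorphB. Qed.

Lemma rmorph_prism (R R' : pzRingType) (f : {rmorphism R -> R'}) n
    (x y : 'I_n.+1 -> R) : f (prism x y) = prism (f \o x) (f \o y).
Proof.
elim: n x y => [|n IH] x y /=; first by rewrite rmorphB.
by rewrite rmorphB !rmorphM !rmorphB IH rmorph_cup.
Qed.

Local Open Scope classical_set_scope.
Local Open Scope ring_scope.

(** * Degrees in the exterior algebra *)

Section ExteriorPowers.
Variables (A : comPzRingType) (N : lmodType A).

Lemma ext_pow_egenM k m (w : exterior N) :
  ext_pow k w -> ext_pow k.+1 (egen m * w).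
Proof.
move=> [p [a [n ->]]].
exists p, a, (fun j l => if unlift ord0 l is Some l' then n j l' else m).
rewrite mulr_sumr; apply: eq_bigr => j _.
rewrite big_ord_recl unlift_none !mulrA -ecstC; congr (_ * _).
by apply: eq_bigr => l _; rewrite liftK.
Qed.

Lemma ext_pow_ecstM k a (w : exterior N) :
  ext_pow k w -> ext_pow k (ecst N a * w).
Proof.
move=> [p [b [n ->]]]; exists p, (fun j => a * b j), n.
by rewrite mulr_sumr; apply: eq_bigr => j _; rewrite rmorphM mulrA.
Qed.

Lemma ext_pow_1 : ext_pow 0 (1 : exterior N).
Proof.
exists 1%N, (fun=> 1), (fun _ _ => 0).
by rewrite big_ord1 big_ord0 rmorph1 mulr1.
Qed.

Lemma ext_pow1_egen (w : exterior N) : ext_pow 1 w -> exists m, w = egen m.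
Proof.
move=> [p [a [n ->]]]; exists (\sum_(j < p) a j *: n j ord0).
by rewrite raddf_sum; apply: eq_bigr => j _; rewrite big_ord1 /= egenZ.
Qed.

Lemma ext_pow_egen m : ext_pow 1 (egen m : exterior N).
Proof. by rewrite -[egen m]mulr1; exact/ext_pow_egenM/ext_pow_1. Qed.

End ExteriorPowers.

(** * Products of closed forms *)

Section ClosedFormProducts.
Variables (K : fieldType) (X : scheme K).
Implicit Types U V : opens X.

Lemma formd_mul_closed U (s t : dform U) :
  formd s = 0 -> formd t = 0 -> formd (s * t) = 0.
Proof.
move=> ds dt; apply/val_inj/dfamP => x.
have /(congr1 (fun w => form_val w x)) /= ds' := ds.
have /(congr1 (fun w => form_val w x)) /= dt' := dt.
by rewrite /= dfamME edM ds' dt' mul0r mulr0 addr0.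
Qed.

Lemma formd_fn_form U a : formd (fn_form a : dform U) =
  form_of (egen (kD (scal U) a)).
Proof.
apply/val_inj/dfamP => x /=.
by rewrite /pgerm -emap_ed ed_cst.
Qed.

Lemma formd_of U (w : pform U) : formd (form_of w) = form_of (ed w).
Proof. by apply/val_inj/dfamP => x; rewrite /= /pgerm emap_ed. Qed.

Lemma form_res_of U V (VU : V `<=` U) (w : pform U) :
  form_res VU (form_of w) = form_of (pres VU w).
Proof. by apply/val_inj/dfamP => x; exact/esym/pgerm_res. Qed.

Lemma form_of_kform U k (w : pform U) : ext_pow k w -> is_kform k (form_of w).
Proof.
move=> wk x Ux; exists U, (@subset_refl _ _), w; split=> // y Uy.
by congr (pgerm _ w); exact: Prop_irrelevance.
Qed.

Lemma kform1_mul U k (s t : dform U) :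
  is_kform 1 s -> is_kform k t -> is_kform k.+1 (s * t).
Proof.
move=> s1 tk x Ux.
have [V [VU [w [Vx /ext_pow1_egen[m wm] sE]]]] := s1 x Ux.
have [W [WU [v [Wx vk tE]]]] := tk x Ux.
have lV := @ocapl _ V W; have rW := @ocapr _ V W.
exists (ocap V W), (subset_trans lV VU), (pres lV w * pres rW v); split=> //.
  by rewrite wm /pres emap_gen; exact/ext_pow_egenM/emap_ext_pow.
move=> y VWy; rewrite rmorphM /= dfamME.
rewrite (pgerm_res lV (lV y VWy)) (pgerm_res rW (rW y VWy)) -sE -tE.
by congr (_ * _); congr (form_val _ (exist _ y _)).
Qed.

Lemma closed_form1_mul U k (s t : dform U) :
  s \in is_closed_kform 1 -> t \in is_closed_kform k ->
  s * t \in is_closed_kform k.+1.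
Proof.
move=> /asboolP[s1 ds] /asboolP[tk dt]; apply/asboolP.
by split; [exact: kform1_mul|exact: formd_mul_closed].
Qed.

(** Locally the form is induced by a single generator, whose square is zero. So closed 1-forms can
    serve as the set [S] of the alternation lemmas. *)
Lemma closed_form1_sqr U (s : dform U) : s \in is_closed_kform 1 -> s * s = 0.
Proof.
move=> /asboolP[s1 _]; apply/val_inj/dfamP => -[x Ux].
have [V [VU [w [Vx /ext_pow1_egen[m wm] sE]]]] := s1 x Ux.
rewrite (Prop_irrelevance Ux (VU x Vx)) /= dfamME.
by rewrite sE -rmorphM wm egen_sqr rmorph0.
Qed.

Lemma closed_form_1 U : (1 : dform U) \in is_closed_kform 0.
Proof.
rewrite -(rmorph1 (@form_of _ _ U)); apply/asboolP; split.
  exact/form_of_kform/ext_pow_1.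
by rewrite formd_of -[1](rmorph1 (@ecst _ _)) ed_cst kD1 !raddf0.
Qed.

Lemma closed_form_cst U k c (s : dform U) :
  s \in is_closed_kform k -> cst_form U c * s \in is_closed_kform k.
Proof.
move=> /asboolP[sk ds]; apply/asboolP; split; last first.
  by apply: formd_mul_closed => //; rewrite formd_fn_form kD_cst !raddf0.
move=> x Ux; have [V [VU [w [Vx wk sE]]]] := sk x Ux.
exists V, VU, (ecst _ (scal V c) * w); split=> //; first exact: ext_pow_ecstM.
move=> y Vy; rewrite rmorphM /= dfamME sE; congr (_ * _).
by rewrite /pgerm !emap_cst /= !germ_scal.
Qed.

Lemma closed_form_sum U k (I : Type) (r : seq I) (P : pred I)
    (F : I -> dform U) :
  (forall i, P i -> F i \in is_closed_kform k) ->
  \sum_(i <- r | P i) F i \in is_closed_kform k.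
Proof.
have [S0 SB] := @is_closed_kform_zmod _ X k U.
move=> SF; apply: (big_ind (fun s => s \in is_closed_kform k)) => // u v Su Sv.
by rewrite -[v]opprK SB // -sub0r SB.
Qed.

Lemma cup_closed U n (x : 'I_n.+1 -> dform U) :
  (forall l, x l \in is_closed_kform 1) -> cup x \in is_closed_kform n.
Proof.
elim: n x => [|n IH] x Sx; first by rewrite cup0 closed_form_1.
rewrite cupS; apply: closed_form1_mul; last by apply: IH => l; exact: Sx.
by apply: (@is_closed_kform_zmod _ X 1 U).2; exact: Sx.
Qed.

Lemma prism_closed U n (x y : 'I_n.+1 -> dform U) :
  (forall l, x l \in is_closed_kform 1) ->
  (forall l, y l \in is_closed_kform 1) ->
  prism x y \in is_closed_kform n.+1.
Proof.
have SB k := (@is_closed_kform_zmod _ X k U).2.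
elim: n x y => [|n IH] x y Sx Sy /=; first exact: SB.
apply: (SB _ _ _); (apply: closed_form1_mul; first exact: SB).
  exact: cup_closed.
by apply: IH => l; [exact: Sx|exact: Sy].
Qed.

End ClosedFormProducts.

(** * Diagonal transition functions of adapted trivializations *)

Section DiagonalTransition.
Variables (X : topologicalType) (O : ring_sheaf X) (M : nat).
Variables (E : mod_sheaf O) (Fl : full_flag E M).

Record triv := Triv {
  triv_dom : opens X;
  triv_fun : forall W : opens X, W `<=` triv_dom ->
    {linear E W -> 'cV[O W]_M};
  trivP : adapted_trivialization Fl triv_fun }.

Arguments triv_fun T {W} WT : rename.

Implicit Types (W V : opens X) (T S : triv).

Lemma triv_flag (p : 'I_M.+1) W T (WT : W `<=` triv_dom T) s :
  Fl p W s <-> forall a : 'I_M, (p <= a)%N -> triv_fun T WT s a 0 = 0.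
Proof. by case: (trivP T) => _ _; apply. Qed.

Lemma triv_res W V T (WT : W `<=` triv_dom T) (VT : V `<=` triv_dom T)
    (VW : V `<=` W) s :
  triv_fun T VT (mres VW s) = map_mx (rres O VW) (triv_fun T WT s).
Proof. by case: (trivP T) => + _ _; apply. Qed.

Lemma triv_basis W T (WT : W `<=` triv_dom T) (v : 'cV[O W]_M) :
  exists e, triv_fun T WT e = v.
Proof. by case: (trivP T) => _ /(_ W WT)[f _ fK] _; exists (f v). Qed.

(* Multiplication by [a] is the transition function from S to T of the
   invertible quotient E_(m+1)/E_m, i.e. the m-th diagonal entry of the matrix
   of T \o S^-1. *)
Definition is_diag_trans W T S (m : 'I_M) (a : O W) : Prop :=
  forall (WT : W `<=` triv_dom T) (WS : W `<=` triv_dom S) s,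
    Fl (lift ord0 m) W s -> triv_fun T WT s m 0 = a * triv_fun S WS s m 0.

(** Choosing the function avoids inclusion proofs as arguments; it is determined by
    [is_diag_trans_eq] as soon as W lies in both domains. *)
Definition diag_trans W T S m : O W := xget 0 [set a | is_diag_trans T S m a].

Lemma diag_trans_ex W T S m (WT : W `<=` triv_dom T)
    (WS : W `<=` triv_dom S) : exists a : O W, is_diag_trans T S m a.
Proof.
have [e Se] := triv_basis WS (delta_mx m 0).
exists (triv_fun T WT e m 0) => WT' WS' s Fs.
rewrite (Prop_irrelevance WT' WT) (Prop_irrelevance WS' WS).
set c := triv_fun S WS s m 0.
(* Subtracting c e kills the m-th S-coordinate and so moves s from E_(m+1) down to E_m, where the
   T-coordinates vanish from the m-th on. *)
have : Fl (widen_ord (leqnSn M) m) W (s - c *: e).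
  apply/(triv_flag _ WS) => a ma.
  rewrite linearB linearZ /= !mxE Se !mxE eqxx andbT.
  have [->|nam] := eqVneq a m; first by rewrite mulr1 subrr.
  rewrite mulr0 subr0; apply: (iffLR (triv_flag _ WS s) Fs).
  by rewrite /= /bump /= add1n ltn_neqAle eq_sym nam.
move/(triv_flag _ WT)/(_ m (leqnn m)).
by rewrite linearB linearZ /= !mxE mulrC => /subr0_eq.
Qed.

Lemma diag_transP W T S m : W `<=` triv_dom T -> W `<=` triv_dom S ->
  is_diag_trans T S m (diag_trans W T S m).
Proof.
move=> WT WS; have [a Ha] := diag_trans_ex m WT WS.
exact: (@xgetI _ _ _ a Ha).
Qed.

Lemma triv_flag_basis W T m (WT : W `<=` triv_dom T) :
  exists2 e, Fl (lift ord0 m) W e & triv_fun T WT e = delta_mx m 0.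
Proof.
have [e Te] := triv_basis WT (delta_mx m 0); exists e => //.
apply/(triv_flag _ WT) => b; rewrite Te mxE /= /bump /= add1n eqxx andbT.
by move=> mb; rewrite -val_eqE gtn_eqF.
Qed.

Lemma is_diag_trans_eq W T S m (a : O W) : W `<=` triv_dom T ->
  W `<=` triv_dom S -> is_diag_trans T S m a -> a = diag_trans W T S m.
Proof.
move=> WT WS Ha; have Hd := diag_transP (m := m) WT WS.
have [e Fe Se] := triv_flag_basis m WS.
by have := Ha WT WS e Fe; rewrite (Hd WT WS e Fe) Se mxE !eqxx !mulr1.
Qed.

Lemma diag_trans_comp W T S R m : W `<=` triv_dom T -> W `<=` triv_dom S ->
  W `<=` triv_dom R ->
  diag_trans W T R m = diag_trans W T S m * diag_trans W S R m.
Proof.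
move=> WT WS WR; apply/esym/is_diag_trans_eq => // WT' WR' s Fs.
by rewrite -mulrA -(diag_transP WS WR WS WR' Fs) -(diag_transP WT WS WT').
Qed.

Lemma diag_trans_refl W T m : W `<=` triv_dom T -> diag_trans W T T m = 1.
Proof.
move=> WT; apply/esym/is_diag_trans_eq => // WT' WR' s Fs.
by rewrite mul1r (Prop_irrelevance WT' WR').
Qed.

Lemma diag_trans_res W V (VW : V `<=` W) T S m : W `<=` triv_dom T ->
  W `<=` triv_dom S ->
  rres O VW (diag_trans W T S m) = diag_trans V T S m.
Proof.
move=> WT WS; have VT := subset_trans VW WT; have VS := subset_trans VW WS.
have [e Fe Se] := triv_flag_basis m WS.
have := diag_transP VT VS VT VS (ssec_res VW Fe).
rewrite (triv_res WT VT VW) (triv_res WS VS VW) Se !mxE !eqxx rmorph1 mulr1.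
by rewrite (diag_transP WT WS WT WS Fe) Se mxE !eqxx mulr1.
Qed.

End DiagonalTransition.

Arguments triv_fun {X O M E Fl} T {W} WT : rename.

(** * Logarithmic derivatives and the forms built from them *)

Section Dlog.
Variables (K : fieldType) (X : scheme K) (M : nat).
Variables (E : mod_sheaf (sch_sheaf X)) (Fl : full_flag E M).
Implicit Types (W V : opens X) (T S R : triv Fl).

(** This is a^-1 da for the m-th diagonal transition function a from S to T; its inverse is the
    transition function from T to S. *)
Definition dlog_trans W m T S : dform W :=
  form_of (egen (diag_trans W S T m *: kD (scal W) (diag_trans W T S m))).

Lemma dlog_trans_closed W m T S : W `<=` triv_dom T -> W `<=` triv_dom S ->
  dlog_trans W m T S \in is_closed_kform 1.
Proof.
move=> WT WS; apply/asboolP; split; first exact/form_of_kform/ext_pow_egen.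
rewrite formd_of ed_gen kdZ kd_D mulr0 addr0.
set b := diag_trans W S T m; set a := diag_trans W T S m.
have ba : b * a = 1 by rewrite -diag_trans_comp // diag_trans_refl.
(* Differentiating b a = 1 gives db = - b^2 da, so db da is a multiple of da da = 0. *)
have : kD (scal W) (b * a) = 0 by rewrite ba kD1.
rewrite kDM => /(congr1 ( *:%R b)); rewrite scalerDr scaler0 !scalerA.
rewrite ba scale1r => /eqP; rewrite addrC addr_eq0 => /eqP ->.
by rewrite raddfN mulNr /= egenZ -mulrA egen_sqr mulr0 oppr0 raddf0.
Qed.

Lemma dlog_transD W m T S R : W `<=` triv_dom T -> W `<=` triv_dom S ->
  W `<=` triv_dom R ->
  dlog_trans W m T R = dlog_trans W m T S + dlog_trans W m S R.
Proof.
move=> WT WS WR; rewrite /dlog_trans -!raddfD /=; congr (form_of (egen _)).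
rewrite (diag_trans_comp m WR WS WT) (diag_trans_comp m WT WS WR) kDM.
rewrite scalerDr !scalerA addrC; congr (_ *: _ + _ *: _).
  by rewrite mulrAC -(diag_trans_comp m WR WS WR) ?diag_trans_refl ?mul1r.
by rewrite -mulrA -(diag_trans_comp m WS WT WS) diag_trans_refl ?mulr1.
Qed.

Lemma dlog_trans_res W V (VW : V `<=` W) m T S :
  W `<=` triv_dom T -> W `<=` triv_dom S ->
  form_res VW (dlog_trans W m T S) = dlog_trans V m T S.
Proof.
move=> WT WS; rewrite form_res_of /pres emap_gen kmapZ kmap_D /=.
by rewrite !diag_trans_res.
Qed.

(** Potentials of the additive cocycle: by [dlog_transD], x_l - x_k is the logarithmic form of the
    pair T_l, T_k. The base T_0 may be replaced by any other, see [cup_dlog_coord]. *)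
Definition dlog_coord W m n (T : 'I_n.+1 -> triv Fl) : 'I_n.+1 -> dform W :=
  fun l => dlog_trans W m (T l) (T ord0).

(** The value of [T_form], by [T_form_triv]. The scalar is what (n+1)! equal terms with coefficient
    1/(n+1)! add up to: 1, or 0 when (n+1)! vanishes in K. *)
Definition triv_form n W (T : 'I_n.+1 -> triv Fl) : dform W :=
  cst_form W ((n.+1)`!%:R / (n.+1)`!%:R) *
  \sum_(m < M) cup (dlog_coord W m T).

Lemma dlog_coord_closed W m n (T : 'I_n.+1 -> triv Fl) :
  (forall l, W `<=` triv_dom (T l)) ->
  forall l, dlog_coord W m T l \in is_closed_kform 1.
Proof. by move=> WT l; exact: dlog_trans_closed. Qed.

Lemma cup_dlog_coord W m n (T : 'I_n.+1 -> triv Fl) S :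
  (forall l, W `<=` triv_dom (T l)) -> W `<=` triv_dom S ->
  cup (fun l => dlog_trans W m (T l) S) = cup (dlog_coord W m T).
Proof.
by move=> WT WS; apply: (@cup_shift _ _ _ _ (dlog_trans W m (T ord0) S)) => l;
   exact: dlog_transD.
Qed.

Lemma triv_form_closed n W (T : 'I_n.+1 -> triv Fl) :
  (forall l, W `<=` triv_dom (T l)) -> triv_form W T \in is_closed_kform n.
Proof.
move=> WT; apply/closed_form_cst/closed_form_sum => m _.
exact/cup_closed/dlog_coord_closed.
Qed.

Lemma triv_form_res n W V (VW : V `<=` W) (T : 'I_n.+1 -> triv Fl) :
  (forall l, W `<=` triv_dom (T l)) ->
  form_res VW (triv_form W T) = triv_form V T.
Proof.
move=> WT; rewrite rmorphM rmorph_sum /=; congr (_ * _).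
  by rewrite form_res_of /pres emap_cst /= rres_scal.
apply: eq_bigr => m _; rewrite rmorph_cup; congr cup; apply/funext => l.
exact: dlog_trans_res.
Qed.

Lemma triv_form_perm n W (T : 'I_n.+1 -> triv Fl) (s : 'S_n.+1) :
  (forall l, W `<=` triv_dom (T l)) ->
  triv_form W (T \o s) = (-1) ^+ s * triv_form W T.
Proof.
move=> WT; rewrite /triv_form [RHS]mulrA -[in RHS]commr_sign -[RHS]mulrA.
rewrite [in RHS]mulr_sumr.
congr (_ * _).
apply: eq_bigr => m _.
rewrite -(cup_dlog_coord m (S := T ord0)) //; last by move=> l; exact: WT.
by rewrite -(cup_perm (@is_closed_kform_zmod _ X 1 W)
    (@closed_form1_sqr _ X W)) //;
   exact: dlog_coord_closed.
Qed.

Lemma triv_form_repeat n W (T : 'I_n.+1 -> triv Fl) a b :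
  (forall l, W `<=` triv_dom (T l)) -> a != b -> T a = T b ->
  triv_form W T = 0.
Proof.
move=> WT ab Tab; rewrite /triv_form big1 ?mulr0 // => m _.
apply: (cup_repeat (@is_closed_kform_zmod _ X 1 W)
    (@closed_form1_sqr _ X W) _ ab).
  exact: dlog_coord_closed.
by rewrite /dlog_coord Tab.
Qed.

Lemma triv_form_coboundary n W (T : 'I_n.+2 -> triv Fl) :
  (forall l, W `<=` triv_dom (T l)) ->
  \sum_(j < n.+2) (-1) ^+ j * triv_form W (T \o lift j) = 0.
Proof.
move=> WT; rewrite /triv_form.
under eq_bigr => j _ do rewrite mulrA -commr_sign -mulrA mulr_sumr.
rewrite -mulr_sumr exchange_big big1 ?mulr0 //= => m _.
rewrite -[RHS](cup_coboundary (dlog_coord W m T)); apply: eq_bigr => j _.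
(* Deleting index 0 changes the base of [dlog_coord]; all faces are brought back to the common base
   T_0. *)
by rewrite -(cup_dlog_coord m (S := T ord0)) // => l; exact: WT.
Qed.

(** Both families are measured against the same base T_0. The prism on n + 1 indices has degree n +
    1, hence the scalar of [triv_form] in that degree, with (n+2)!. *)
Definition prism_form n W (T S : 'I_n.+1 -> triv Fl) : dform W :=
  cst_form W ((n.+2)`!%:R / (n.+2)`!%:R) *
  \sum_(m < M) prism (dlog_coord W m T)
                     (fun l => dlog_trans W m (S l) (T ord0)).

Lemma prism_form_closed n W (T S : 'I_n.+1 -> triv Fl) :
  (forall l, W `<=` triv_dom (T l)) -> (forall l, W `<=` triv_dom (S l)) ->
  prism_form W T S \in is_closed_kform n.+1.
Proof.
move=> WT WS; apply/closed_form_cst/closed_form_sum => m _.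
apply: prism_closed => l; first exact: dlog_coord_closed.
exact: dlog_trans_closed.
Qed.

Lemma prism_form_res n W V (VW : V `<=` W) (T S : 'I_n.+1 -> triv Fl) :
  (forall l, W `<=` triv_dom (T l)) -> (forall l, W `<=` triv_dom (S l)) ->
  form_res VW (prism_form W T S) = prism_form V T S.
Proof.
move=> WT WS; rewrite rmorphM rmorph_sum /=; congr (_ * _).
  by rewrite form_res_of /pres emap_cst /= rres_scal.
apply: eq_bigr => m _; rewrite rmorph_prism.
by congr prism; apply/funext => l; exact: dlog_trans_res.
Qed.

Lemma prism_form_coboundary n W (T S : 'I_n.+2 -> triv Fl) :
  (forall l, W `<=` triv_dom (T l)) -> (forall l, W `<=` triv_dom (S l)) ->
  \sum_(j < n.+2) (-1) ^+ j * prism_form W (T \o lift j) (S \o lift j) =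
  triv_form W S - triv_form W T.
Proof.
move=> WT WS; rewrite /prism_form /triv_form -mulrBr -sumrB.
under eq_bigr => j _ do rewrite mulrA -commr_sign -mulrA mulr_sumr.
rewrite -mulr_sumr exchange_big; congr (_ * _); apply: eq_bigr => m _ /=.
rewrite -(cup_dlog_coord m WS (WT ord0)) -prism_coboundary.
apply: eq_bigr => j _; congr (_ * _).
apply: (@prism_shift _ _ _ _ _ _
  (dlog_trans W m (T ord0) ((T \o lift j) ord0)));
  by move=> l; apply: dlog_transD => //; exact: WT.
Qed.

End Dlog.

(** * Upper triangular matrices and inverses *)

Section UpperTriangular.
Variables (R : pzRingType) (M : nat).
Implicit Types A B : 'M[R]_M.

Definition upper_trig A := forall a b : 'I_M, (b < a)%N -> A a b = 0.

Lemma upper_trig_mul A B :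
  upper_trig A -> upper_trig B -> upper_trig (A *m B).
Proof.
move=> uA uB a b ba; rewrite mxE big1 // => c _.
have [ca|ac] := ltnP c a; first by rewrite uA ?mul0r.
by rewrite uB ?mulr0 // (leq_trans ba).
Qed.

Lemma upper_trig_mul_diag A B m :
  upper_trig A -> upper_trig B -> (A *m B) m m = A m m * B m m.
Proof.
move=> uA uB; rewrite mxE (bigD1 m) //= big1 ?addr0 // => c.
rewrite neq_ltn => /orP[cm|mc]; first by rewrite uA ?mul0r.
by rewrite uB ?mulr0.
Qed.

Lemma trace_prod_upper_trig (I : Type) (r : seq I) (F : I -> 'M[R]_M) :
  (forall i, upper_trig (F i)) ->
  \tr (\prod_(i <- r) F i) = \sum_m \prod_(i <- r) F i m m.
Proof.
move=> uF; suff [_ E] : upper_trig (\prod_(i <- r) F i) /\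
    forall m, (\prod_(i <- r) F i) m m = \prod_(i <- r) F i m m.
  by apply: eq_bigr => m _; exact: E.
elim: r => [|i r [uP E]].
  rewrite big_nil; split=> [a b ba|m]; last by rewrite big_nil mxE eqxx.
  by rewrite mxE -val_eqE gtn_eqF.
rewrite big_cons; split=> [|m]; first exact: upper_trig_mul.
by rewrite big_cons -E; exact: upper_trig_mul_diag.
Qed.

End UpperTriangular.

Lemma mulmx_id_eq1 (R : pzRingType) n (A : 'M[R]_n) :
  (forall v : 'cV_n, A *m v = v) -> A = 1%:M.
Proof.
move=> H; apply/matrixP => a b; have /colP/(_ a) := H (delta_mx b 0).
by rewrite -colE !mxE eqxx andbT.
Qed.

Lemma mxinv_eq (R : comPzRingType) n (A B : 'M[R]_n) :
  A *m B = 1%:M -> B *m A = 1%:M -> mxinv A = B.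
Proof.
move=> AB BA; have [AC CA] : A *m mxinv A = 1%:M /\ mxinv A *m A = 1%:M.
  exact: (xgetI A (P := [set C | A *m C = 1%:M /\ C *m A = 1%:M]) (conj AB BA)).
by rewrite -[LHS]mulmx1 -AB mulmxA CA mul1mx.
Qed.

(** * From transition matrices to trivializations *)

Section TransitionSystem.
Variables (K : fieldType) (X : scheme K) (M : nat).
Variables (E : mod_sheaf (sch_sheaf X)) (Fl : full_flag E M).
Local Notation O := (sch_sheaf X).
Variable U : open_cover X.
Variable g : forall i j : cov_idx U, 'M[O (ocap (U i) (U j))]_M.
Variable T : cov_idx U -> triv Fl.
Hypothesis UT : forall i, U i `<=` triv_dom (T i).
Hypothesis gT : forall i j (W : opens X) (WT : W `<=` triv_dom (T i))
  (WS : W `<=` triv_dom (T j)) (Wij : W `<=` ocap (U i) (U j)) s,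
  triv_fun (T i) WT s = map_mx (rres O Wij) (g i j) *m triv_fun (T j) WS s.

Let capT i j : ocap (U i) (U j) `<=` triv_dom (T i).
Proof. by move=> x [/UT]. Qed.

Let capS i j : ocap (U i) (U j) `<=` triv_dom (T j).
Proof. by move=> x [_ /UT]. Qed.

Let ocapC i j : ocap (U i) (U j) `<=` ocap (U j) (U i).
Proof. by move=> x []. Qed.

Let gTcap i j s :
  triv_fun (T i) (@capT i j) s = g i j *m triv_fun (T j) (@capS i j) s.
Proof.
rewrite (gT _ (@capS i j) (@subset_refl _ _)); congr (_ *m _).
by apply/matrixP => a b; rewrite mxE rres_id.
Qed.

(** Column b of g_ij holds the T_i-coordinates of the section whose T_j-coordinates are the b-th
    unit vector. That section lies in E_(b+1). *)
Lemma trans_upper_trig i j : upper_trig (g i j).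
Proof.
move=> a b ba; have [e Fe Te] := triv_flag_basis b (@capS i j).
have := iffLR (triv_flag _ (@capT i j) _) Fe a; rewrite gTcap Te -colE mxE.
by apply; rewrite /= /bump /= add1n.
Qed.

Lemma trans_diag i j m :
  g i j m m = diag_trans (ocap (U i) (U j)) (T i) (T j) m.
Proof.
apply: is_diag_trans_eq => // WT WS s /(triv_flag _ WS) Fs.
rewrite (Prop_irrelevance WT (@capT i j)) gTcap mxE.
rewrite (Prop_irrelevance WS (@capS i j)) in Fs *.
rewrite (bigD1 m) //= big1 ?addr0 // => c.
rewrite neq_ltn => /orP[cm|mc]; first by rewrite trans_upper_trig ?mul0r.
by rewrite Fs ?mulr0 //= /bump /= add1n.
Qed.

(** Every coordinate vector comes from a section of E, and on such vectors both products of the two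
    matrices act as the identity. *)
Lemma mxinv_trans i j : mxinv (g i j) = map_mx (rres O (@ocapC i j)) (g j i).
Proof.
apply: mxinv_eq; apply: mulmx_id_eq1 => v; rewrite -mulmxA.
  have [s <-] := triv_basis (@capT i j) v.
  by rewrite -(gT (@capS i j) (@capT i j)) -gTcap.
have [s <-] := triv_basis (@capS i j) v.
by rewrite -gTcap -(gT (@capS i j)).
Qed.

Lemma dlog_upper_trig i j : upper_trig (dlog g i j).
Proof.
apply: upper_trig_mul => a b ba; rewrite mxE.
  by rewrite mxinv_trans mxE trans_upper_trig // rmorph0 /fn_form !raddf0.
by rewrite trans_upper_trig // /fn_form !raddf0.
Qed.

Lemma dlog_diag i j m :
  dlog g i j m m = dlog_trans (ocap (U i) (U j)) m (T i) (T j).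
Proof.
rewrite upper_trig_mul_diag.
- rewrite !mxE mxinv_trans mxE !trans_diag diag_trans_res // formd_fn_form.
  by rewrite -rmorphM -egenZ.
- move=> a b ba; rewrite mxE mxinv_trans mxE trans_upper_trig // rmorph0.
  by rewrite /fn_form !raddf0.
- by move=> a b ba; rewrite mxE trans_upper_trig // /fn_form !raddf0.
Qed.

Lemma cst_formZ (W : opens X) n c :
  cst_form W ((-1) ^+ n * c) = (-1) ^+ n * cst_form W c :> dform W.
Proof. by rewrite /cst_form /fn_form !rmorphM /= !rmorph_sign. Qed.

Lemma T_form_triv k (i : 'I_k.+1 -> cov_idx U) :
  T_form g i = triv_form (obigcap (U \o i)) (T \o i).
Proof.
set W := obigcap _.
have WT l : W `<=` triv_dom (T (i l)) by move=> x Wx; exact/UT/Wx.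
rewrite /T_form.
(* Each permutation contributes the same term: the sign from [cup_perm] cancels the sign in the
   coefficient. *)
transitivity (\sum_(s : 'S_k.+1) cst_form W (k.+1)`!%:R^-1 *
    \sum_m cup (dlog_coord W m (T \o i))).
  apply: eq_bigr => s _; rewrite cst_formZ -mulrA.
  rewrite trace_prod_upper_trig; last first.
    by move=> l a b ba; rewrite mxE dlog_upper_trig // raddf0.
  rewrite (_ : \sum_m _ = (-1) ^+ s * \sum_m cup (dlog_coord W m (T \o i))).
    by rewrite [cst_form _ _ * _]mulrA commr_sign -mulrA signrMK.
  rewrite mulr_sumr; apply: eq_bigr => m _.
  have Sx := dlog_coord_closed m WT.
  rewrite -(cup_perm (@is_closed_kform_zmod _ X 1 W)
    (@closed_form1_sqr _ X W)) //.
  rewrite -(starprod_cup (@is_closed_kform_zmod _ X 1 W)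
    (@closed_form1_sqr _ X W));
    last by move=> l; exact: Sx.
  apply: eq_bigr => l _; rewrite mxE dlog_diag.
  rewrite dlog_trans_res; [|exact: capT|exact: capS].
  rewrite /= /dlog_coord (dlog_transD m (WT _) (WT (s ord_max)) (WT ord0)).
  by rewrite addrK.
rewrite sumr_const card_Sn /triv_form mulr_natl /cst_form /fn_form !raddfMn /=.
by rewrite mulrnAl.
Qed.

End TransitionSystem.

(** * Sorting families of indices *)

Section Sorting.
Variables (d : Order.disp_t) (I : orderType d) (n : nat).

Lemma increasing_sorted (i : 'I_n -> I) :
  increasing i = sorted <%O [seq i a | a <- enum 'I_n].
Proof.
apply/idP/idP => [/forallP H|Hi].
  rewrite (sorted_pairwise lt_trans) pairwise_map.
  have : sorted (relpre val ltn) (enum 'I_n).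
    by rewrite -sorted_map val_enum_ord iota_ltn_sorted.
  rewrite sorted_pairwise; last by move=> a b c; exact: ltn_trans.
  apply: sub_pairwise => a b ab.
  by have /forallP/(_ b)/implyP := H a; apply.
apply/forallP => a; apply/forallP => b; apply/implyP => ab.
have nthE (c : 'I_n) : nth (i a) [seq i a | a <- enum 'I_n] c = i c.
  by rewrite (nth_map c) ?size_enum_ord // nth_ord_enum.
have := lt_sorted_ltn_nth (i a) Hi (x := nat_of_ord a) (y := nat_of_ord b).
by rewrite !nthE !inE size_map size_enum_ord !ltn_ord ab => ->.
Qed.

Lemma increasing_perm_uniq (i : 'I_n -> I) (s t : 'S_n) :
  injective i -> increasing (i \o s) -> increasing (i \o t) -> s = t.
Proof.
move=> inj_i; rewrite !increasing_sorted => Hs Ht.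
have /eq_in_map st : [seq (i \o s) a | a <- enum 'I_n] =
                     [seq (i \o t) a | a <- enum 'I_n].
  apply: lt_sorted_eq Hs Ht _ => x.
  apply/mapP/mapP => -[a _ ->].
    by exists (t^-1%g (s a)); rewrite ?mem_enum //= permKV.
  by exists (s^-1%g (t a)); rewrite ?mem_enum //= permKV.
by apply/permP => a; apply/inj_i/st; rewrite mem_enum.
Qed.

Lemma increasing_perm_ex (i : 'I_n -> I) :
  injective i -> exists s : 'S_n, increasing (i \o s).
Proof.
move=> inj_i; pose t := [tuple i a | a < n].
have /tuple_permP[s Es] : perm_eq (sort <=%O t) t by rewrite perm_sort.
exists s; rewrite increasing_sorted.
rewrite (_ : [seq _ | _ <- _] = sort <=%O t).
  by rewrite sort_lt_sorted map_inj_uniq ?enum_uniq.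
by rewrite Es; apply: eq_map => a; rewrite tnth_mktuple.
Qed.

End Sorting.

(** * Cech cocycles from trivializations and their pullbacks *)

Section CechForms.
Variables (K : fieldType) (X : scheme K).

Lemma cform_val_sum n (W : opens X) (J : Type) (r : seq J) (P : pred J)
    (F : J -> closed_form n W) :
  cform_val (\sum_(j <- r | P j) F j) = \sum_(j <- r | P j) cform_val (F j).
Proof. exact: (raddf_sum (val : closed_form n W -> dform W)). Qed.

Lemma cform_val_sign n (W : opens X) (a : closed_form n W) e :
  cform_val (a *~ (-1) ^+ e) = (-1) ^+ e * cform_val a.
Proof.
transitivity (cform_val a *~ (-1) ^+ e).
  exact: (raddfMz (val : closed_form n W -> dform W)).
by rewrite -mulrzl rmorphXn /= rmorphN1.
Qed.

Lemma cform_val_cech_diff n m (C : open_cover X)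
    (c : cochain (closed_forms X n) C m) (i : 'I_m.+2 -> cov_idx C) i_incr :
  cform_val (cech_diff c (i := i) i_incr) =
  \sum_(j < m.+2) (-1) ^+ j *
    form_res (@obigcap_reindex X _ _ (C \o i) (lift j))
      (cform_val (c (i \o lift j) (increasing_lift j i_incr))).
Proof.
by rewrite cform_val_sum; apply: eq_bigr => j _; rewrite cform_val_sign.
Qed.

(** Equal cochains differ by the coboundary of 0; degree 0 is treated apart because there
    [is_coboundary] means vanishing. *)
Lemma cech_step_refine n (C D : open_cover X)
   (z : cocycle (closed_forms X n) C n) (w : cocycle (closed_forms X n) D n) r
   (rP : forall j, D j `<=` C (r j)) :
  (forall j j_incr, cform_val (cocycle_val w j_incr) = 
     cform_val (cech_pullback rP z (i := j) j_incr)) ->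
  cech_step (existT (fun U => cocycle (closed_forms X n) U n) C z)
            (existT (fun U => cocycle (closed_forms X n) U n) D w).
Proof.
move=> H; exists r, rP; case: n z w H => [|n] z w H.
  by move=> j j_incr /=; rewrite (val_inj (H j j_incr)) subrr.
exists (fun _ _ => 0) => j j_incr /=; rewrite (val_inj (H j j_incr)) subrr.
by rewrite /cech_diff big1 // => a _; rewrite raddf0 mul0rz.
Qed.

Variables (M : nat) (E : mod_sheaf (sch_sheaf X)) (Fl : full_flag E M).

Section OneCover.
Variables (C : open_cover X) (T : cov_idx C -> triv Fl).
Hypothesis CT : forall i, C i `<=` triv_dom (T i).

Lemma obigcap_triv n (i : 'I_n -> cov_idx C) l :
  obigcap (C \o i) `<=` triv_dom ((T \o i) l).
Proof. by move=> x Cx; exact/CT/Cx. Qed.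

Definition triv_cochain n : cochain (closed_forms X n) C n := fun i _ =>
  ClosedForm (triv_form_closed (obigcap_triv (i := i))).

Lemma triv_cochain_cocycle n (i : 'I_n.+2 -> cov_idx C) i_incr :
  cech_diff (@triv_cochain n) (i := i) i_incr = 0.
Proof.
apply: val_inj; rewrite [LHS]cform_val_cech_diff.
rewrite -[RHS](triv_form_coboundary (obigcap_triv (i := i))).
apply: eq_bigr => j _; congr (_ * _); apply: triv_form_res => l.
exact: obigcap_triv.
Qed.

Definition triv_cocycle n : cocycle (closed_forms X n) C n :=
  Cocycle (@triv_cochain_cocycle n).

(** If r \o j is injective, exactly one permutation sorts it, and its sign cancels that of
    [triv_form_perm]. Otherwise a trivialization is repeated and both sides vanish by
    [triv_form_repeat]. *)
Lemma cech_pullback_triv n (D : open_cover X) (r : cov_idx D -> cov_idx C)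
    (rP : forall j, D j `<=` C (r j)) (c : cochain (closed_forms X n) C n) :
  (forall i i_incr, cform_val (c i i_incr) =
    triv_form (obigcap (C \o i)) (T \o i)) ->
  forall j j_incr, cform_val (cech_pullback rP c (i := j) j_incr) =
    triv_form (obigcap (D \o j)) (T \o r \o j).
Proof.
move=> cT j j_incr; set W := obigcap _.
have WT l : W `<=` triv_dom ((T \o r \o j) l).
  by move=> x Wx; exact/CT/rP/Wx.
rewrite cform_val_sum.
transitivity (\sum_(s : 'S_n.+1)
    if increasing (r \o j \o s) then triv_form W (T \o r \o j) else 0).
  apply: eq_bigr => s _; case: {-}_ / idP => [h|/negP/negbTE-> //].
  rewrite cform_val_sign h.
  rewrite [cform_val _](_ : _ = triv_form W (T \o r \o j \o s)).
    by rewrite triv_form_perm // signrMK.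
  by rewrite /= cT triv_form_res //; exact: obigcap_triv.
have [inj_rj|] := pselect (injective (r \o j)).
  have [s0 Hs0] := increasing_perm_ex inj_rj.
  rewrite (bigD1 s0) //= Hs0 big1 ?addr0 // => s ns.
  case: ifPn => // Hs; case/eqP: ns; exact: increasing_perm_uniq Hs Hs0.
move=> /existsNP[a /existsNP[b /not_implyP[rab /eqP nab]]].
rewrite (triv_form_repeat WT nab); last by rewrite /= [r (j a)]rab.
by rewrite big1 // => s _; rewrite if_same.
Qed.

End OneCover.

Section CommonRefinement.
Variables (C D : open_cover X).

(** The lexicographic order makes the pairs a totally ordered index set. Only the covering proof is
    opaque, so the index type and the open sets still compute. *)
Definition meet_cover : open_cover X.
Proof.
refine (@Cover X _ (cov_idx C *l cov_idx D)%type
  (fun p => ocap (C p.1) (D p.2)) _).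
abstract (move=> x; have [i Ci] := cov_covers C x;
  by have [j Dj] := cov_covers D x; exists (i, j)).
Defined.

Lemma meet_cover_fst p : meet_cover p `<=` C p.1.
Proof. exact: ocapl. Qed.

Lemma meet_cover_snd p : meet_cover p `<=` D p.2.
Proof. exact: ocapr. Qed.

End CommonRefinement.

End CechForms.

(* Independence of the cover *)
Local Close Scope classical_set_scope.

Lemma transition_system_form (K : fieldType) (X : scheme K) (M : nat)
    (E : mod_sheaf (sch_sheaf X)) (Fl : full_flag E M) (U : open_cover X)
    (g : forall i j : cov_idx U, 'M[sch_sheaf X (ocap (U i) (U j))]_M) :
  transition_system Fl g ->
  exists T : cov_idx U -> triv Fl,
    (forall i, (U i `<=` triv_dom (T i))%classic) /\
    (forall k (i : 'I_k.+1 -> cov_idx U),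
      T_form g i = triv_form (obigcap (U \o i)) (T \o i)).
Proof.
move=> [phi [phiP gP]]; exists (fun i => Triv (phiP i)).
split=> [i|k i]; first exact: subset_refl.
by apply: T_form_triv => [a|a b W WT WS Wab s]; [exact: subset_refl|exact: gP].
Qed.

Lemma cech_class_equiv (X : topologicalType) (F : ab_presheaf X) n
    (U V : open_cover X) (z : cocycle F U n) (w : cocycle F V n) :
  cech_equiv (existT (fun U => cocycle F U n) U z)
             (existT (fun U => cocycle F U n) V w) ->
  cech_class z = cech_class w.
Proof.
move=> zw; apply: eq_exist; apply/funext => y; apply/propext; split=> H.
  by apply: rst_trans H; exact: rst_sym.
exact: rst_trans H.
Qed.

Theorem mainTheorem13 (K : fieldType)
    (char_neq2 : 2%N \notin [pchar K]) (char_neq3 : 3%N \notin [pchar K])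
    (X : scheme K) (M : nat) (E : mod_sheaf (sch_sheaf X))
    (E_free : locally_free_of_rank M (full_subsheaf E))
    (Fl : full_flag E M) (k : nat) (k_gt0 : (1 <= k)%N) :
  (forall (U : open_cover X)
      (g : forall i j : cov_idx U, 'M[sch_sheaf X (ocap (U i) (U j))]_M),
    transition_system Fl g ->
    exists z : cocycle (closed_forms X k) U k,
      forall (i : 'I_k.+1 -> cov_idx U) (i_incr : increasing i),
        cform_val (cocycle_val z i_incr) = T_form g i)
  /\
  (forall (U V : open_cover X)
      (g : forall i j : cov_idx U, 'M[sch_sheaf X (ocap (U i) (U j))]_M)
      (h : forall i j : cov_idx V, 'M[sch_sheaf X (ocap (V i) (V j))]_M),
    transition_system Fl g -> transition_system Fl h ->
    forall (z : cocycle (closed_forms X k) U k)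
      (w : cocycle (closed_forms X k) V k),
      (forall (i : 'I_k.+1 -> cov_idx U) (i_incr : increasing i),
        cform_val (cocycle_val z i_incr) = T_form g i) ->
      (forall (j : 'I_k.+1 -> cov_idx V) (j_incr : increasing j),
        cform_val (cocycle_val w j_incr) = T_form h j) ->
      cech_class z = cech_class w).
Proof.
split=> [U g /transition_system_form[T [UT gT]]|U V g h].
  by exists (triv_cocycle UT k) => i i_incr; rewrite gT.
move=> /transition_system_form[S [US gS]] /transition_system_form[T [VT hT]].
(* In positive degree [is_coboundary] asks for a cochain one degree lower, which the prism will
   supply. *)
case: k k_gt0 => // n _ z w zE wE; apply: cech_class_equiv.
pose W := meet_cover U V.
have WS p : (W p `<=` triv_dom (S p.1))%classic.
  exact/(subset_trans _ (US p.1))/meet_cover_fst.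
have WT p : (W p `<=` triv_dom (T p.2))%classic.
  exact/(subset_trans _ (VT p.2))/meet_cover_snd.
(* [zW] is built from the trivializations S alone, so z pulls back to it exactly, and w up to a
   coboundary. *)
pose zW := triv_cocycle WS n.+1.
apply: (rst_trans _ _ _ (existT (fun U => cocycle _ U n.+1) W zW)).
  apply/rst_step/(cech_step_refine (rP := @meet_cover_fst _ _ U V)) => j j_incr.
  rewrite (cech_pullback_triv US) //; last by move=> i i_incr; rewrite zE gS.
apply/rst_sym/rst_step.
exists snd, (@meet_cover_snd _ _ U V).
(* The coboundary of the prism from T to S is the form of S minus the form of T, that is, [zW] minus
   the pullback of w. *)
pose b : cochain (closed_forms X n.+1) W n := fun i _ =>
  ClosedForm (prism_form_closed (obigcap_triv WT (i := i))
                                (obigcap_triv WS (i := i))).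
exists b => j j_incr; apply: val_inj; rewrite [RHS]cform_val_cech_diff.
transitivity (triv_form (obigcap (W \o j)) (S \o fst \o j) -
              triv_form (obigcap (W \o j)) (T \o snd \o j)).
  congr (_ - _); apply: (cech_pullback_triv VT) => i i_incr.
  by rewrite wE hT.
rewrite -(prism_form_coboundary (obigcap_triv WT (i := j))
                                (obigcap_triv WS (i := j))).
apply: eq_bigr => a _; congr (_ * _); apply/esym/prism_form_res => l.
  exact: (obigcap_triv WT).
exact: (obigcap_triv WS).
Qed.
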